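(* Let $0<s<n$, let $f\in L^1(\mathbb{R}^n)$, and let $1\leq r<\frac{n}{n-s}$. Let $|\!|\!|\cdot|\!|\!|_{L^{\frac{n}{n-s},\infty}(\mathbb{R}^n)}$ be the norm associated with the exponent $r$ (see context). Then $$|\!|\!| I_{s}(f) |\!|\!|_{L^{\frac{n}{n-s},\infty}(\mathbb{R}^n)} \leq \gamma_s v_{n}^{\frac{n-s}{n}}\left(\frac{n}{n-(n-s)r}\right)^{\frac{1}{r}}\|f\|_{L^1(\mathbb{R}^n)},$$ and $$|\!|\!| M_{s}(f) |\!|\!|_{L^{\frac{n}{n-s},\infty}(\mathbb{R}^n)} = \left(\frac{n}{n-(n-s)r}\right)^{\frac{1}{r}}\|f\|_{L^1(\mathbb{R}^n)}.$$ Moreover, if $0<f\in L^1(\mathbb{R}^n)$, then $$|\!|\!| I_{s}(f) |\!|\!|_{L^{\frac{n}{n-s},\infty}(\mathbb{R}^n)}=\gamma_s v_{n}^{\frac{n-s}{n}}\left(\frac{n}{n-(n-s)r}\right)^{\frac{1}{r}}\|f\|_{L^1(\mathbb{R}^n)}.$$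
   Context: For $0<s<n$, the Riesz potential of $f$ is $$I_{s}(f)(x)=\gamma_s\int_{\mathbb{R}^n}\frac{f(x-y)}{|y|^{n-s}}\,dy,\qquad \gamma_s=2^{-s}\pi^{-\frac{n}{2}}\frac{\Gamma(\frac{n-s}{2})}{\Gamma(\frac{s}{2})}.$$ The centered fractional maximal function is $$M_{s}f(x)=\sup_{\rho>0}\frac{1}{|B(x,\rho)|^{1-\frac{s}{n}}}\int_{B(x,\rho)}|f(y)|\,dy,$$ where $B(x,\rho)$ is the ball of center $x$ and radius $\rho$, and $|E|$ denotes the Lebesgue measure of a measurable set $E$. The number $v_n$ is the volume of the unit ball in $\mathbb{R}^n$. For $0<r<\frac{n}{n-s}$, define $$|\!|\!| g |\!|\!|_{L^{\frac{n}{n-s},\infty}(\mathbb{R}^n)}=\sup_{0<|E|<\infty}|E|^{-\frac{1}{r}+\frac{n-s}{n}}\left(\int_E|g|^r\,dx\right)^{\frac{1}{r}},$$ the supremum being over measurable sets $E\subset\mathbb{R}^n$ with $0<|E|<\infty$ (the quantity depends on $r$, which is suppressed from the notation). *)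

(* Defs.v *)
From HB Require Import structures.
From mathcomp Require Import all_boot all_order all_algebra.
From mathcomp Require Import all_classical all_reals all_analysis.

Set Implicit Arguments.
Unset Strict Implicit.
Unset Printing Implicit Defensive.

Import Order.TTheory GRing.Theory Num.Theory.
Import numFieldNormedType.Exports.

Local Open Scope classical_set_scope.
Local Open Scope ring_scope.

(* Lebesgue measure on R^n, the library having it for n = 1 only: outer measure
   by countable families of closed boxes, then restriction to the Caratheodory
   measurable sets. *)
Section lebesgue_outer.
Context (R : realType) (n : nat).
Implicit Types (c : 'rV[R]_n * 'rV[R]_n) (A : set 'rV[R]_n).

Definition box c : set 'rV[R]_n := [set x | forall i, c.1 0 i <= x 0 i <= c.2 0 i].

Definition box_vol c : R := \prod_(i < n) Num.max 0 (c.2 0 i - c.1 0 i).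

(* The index set D may be empty: for n = 0 there is no box of volume 0. *)
Definition box_cover A : set (set nat * (nat -> 'rV[R]_n * 'rV[R]_n)) :=
  [set F | A `<=` \bigcup_(k in F.1) box (F.2 k)].

Definition lebesgue_outer A : \bar R :=
  ereal_inf [set \esum_(k in F.1) (box_vol (F.2 k))%:E | F in box_cover A].

Lemma box_vol_ge0 c : 0 <= box_vol c.
Proof. by apply: prodr_ge0 => i _; rewrite le_max lexx. Qed.

Local Open Scope ereal_scope.

Lemma lebesgue_outer_ge0 A : 0 <= lebesgue_outer A.
Proof.
apply: le_ereal_inf_tmp => _ [F _ <-]; apply: esum_ge0 => k _.
by rewrite lee_fin box_vol_ge0.
Qed.

Lemma lebesgue_outer0 : lebesgue_outer set0 = 0.
Proof.
apply/eqP; rewrite eq_le lebesgue_outer_ge0 andbT.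
apply: ereal_inf_lbound; exists (set0, fun=> (0%R, 0%R)); first by [].
by rewrite /= esum_set0.
Qed.

Lemma le_lebesgue_outer : {homo lebesgue_outer : A B / A `<=` B >-> A <= B}.
Proof.
move=> A B AB; apply: ereal_inf_le_tmp => _ [F BF <-].
by exists F => //; exact: subset_trans AB BF.
Qed.

Lemma lebesgue_outer_sigma_subadditive : sigma_subadditive lebesgue_outer.
Proof.
move=> A; have [[i ioo]|] := pselect (exists i, lebesgue_outer (A i) = +oo).
  rewrite (eseries_pinfty _ _ ioo) ?leey// => k _.
  by rewrite -ltNye (lt_le_trans _ (lebesgue_outer_ge0 _)).
rewrite -forallNE => Aoo.
apply/lee_addgt0Pr => e e0.
apply: le_trans (epsilon_trick _ _ (ltW e0)); last first.
  by move=> k; exact: lebesgue_outer_ge0.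
pose P k F := box_cover (A k) F /\
  \esum_(j in F.1) (box_vol (F.2 j))%:E <=
  lebesgue_outer (A k) + (e / (2 ^ k.+1)%:R)%:E.
have [G PG] : {G & forall k, P k (G k)}.
  apply: (@choice _ _ P) => k.
  have ek : (0 < e / (2 ^ k.+1)%:R)%R.
    by rewrite divr_gt0// ltr0n expn_gt0.
  have fA : lebesgue_outer (A k) \is a fin_num.
    by rewrite ge0_fin_numE ?lebesgue_outer_ge0// ltey; apply/eqP/Aoo.
  have [_ [F AF <-] FA] := lb_ereal_inf_adherent ek fA.
  by exists F; split => //; exact: ltW.
have /card_esym/ppcard_eqP[f] := card_nat2.
pose D := [set ij : nat * nat | (G ij.1).1 ij.2].
apply: (@le_trans _ _ (\esum_(ij in D) (box_vol ((G ij.1).2 ij.2))%:E)).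
  apply: ereal_inf_lbound.
  exists (f @^-1` D, fun k => (G (f k).1).2 (f k).2).
    move=> x [k _ /(PG k).1 [j Dj Bj]].
    by exists (f^-1%FUN (k, j)) => /=; rewrite /= invK ?inE.
  rewrite /= -(@reindex_esum _ _ _ (f @^-1` D) D f
    (fun ij => (box_vol ((G ij.1).2 ij.2))%:E))//.
  split => [k //|j k _ _|ij Dij]; first by apply: inj; rewrite inE.
  by exists (f^-1%FUN ij); rewrite /= invK ?inE.
rewrite [leLHS](_ : _ =
    \sum_(i <oo) \esum_(j in (G i).1) (box_vol ((G i).2 j))%:E); last first.
  rewrite nneseries_esumT; last first.
    by move=> i; apply: esum_ge0 => j _; rewrite lee_fin box_vol_ge0.
  rewrite esum_esum; last by move=> i j _ _; rewrite lee_fin box_vol_ge0.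
  by congr esum; apply/seteqP; split => [[i j]//|[i j] []].
apply: lee_nneseries => [i _ _|i _]; last exact: (PG i).2.
by apply: esum_ge0 => j _; rewrite lee_fin box_vol_ge0.
Qed.

HB.instance Definition _ := isOuterMeasure.Build R 'rV[R]_n lebesgue_outer
  lebesgue_outer0 lebesgue_outer_ge0 le_lebesgue_outer
  lebesgue_outer_sigma_subadditive.

End lebesgue_outer.

(* R^n with the sigma-algebra of Lebesgue measurable sets *)
Notation Rn R n := (caratheodory_type (@lebesgue_outer R n)).

Definition lebesgue (R : realType) (n : nat) : set (Rn R n) -> \bar R :=
  @lebesgue_outer R n.
Arguments lebesgue : clear implicits.

HB.instance Definition _ (R : realType) (n : nat) := isMeasure.Build _ _ _
  (lebesgue R n)
  (@caratheodory_measure0 _ _ (@lebesgue_outer R n))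
  (@caratheodory_measure_ge0 _ _ (@lebesgue_outer R n))
  (@caratheodory_measure_sigma_additive _ _ (@lebesgue_outer R n)).

Section riesz.
Context (R : realType) (n : nat).

(* The canonical norm on 'rV[R]_n is the sup norm. *)
Definition enorm (x : 'rV[R]_n) : R := Num.sqrt (\sum_(i < n) x 0 i ^+ 2).

Definition eball (x : 'rV[R]_n) (rho : R) : set (Rn R n) :=
  [set y | enorm (y - x) < rho].

Definition unit_ball_vol : R := fine (lebesgue R n (eball 0 1)).

Definition Gamma (a : R) : R :=
  \int[lebesgue_measure]_(t in `]0, +oo[) (t `^ (a - 1) * expR (- t)).

Definition riesz_const (s : R) : R :=
  2 `^ (- s) * pi `^ (- (n%:R / 2)) * (Gamma ((n%:R - s) / 2) / Gamma (s / 2)).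

(* \bar R-valued: the integral may diverge on a null set. *)
Definition riesz_potential (s : R) (f : 'rV[R]_n -> R) (x : 'rV[R]_n) : \bar R :=
  ((riesz_const s)%:E *
   \int[lebesgue R n]_y (f (x - y)%R / enorm y `^ (n%:R - s))%:E)%E.

Definition frac_maximal (s : R) (f : 'rV[R]_n -> R) (x : 'rV[R]_n) : \bar R :=
  ereal_sup [set (lebesgue R n (eball x rho) `^ (1 - s / n%:R))^-1 *
                 \int[lebesgue R n]_(y in eball x rho) `|f y|%:E
            | rho in [set rho : R | (0 < rho)%R]]%E.

(* |||g|||_{L^{n/(n-s),oo}}, computed with the exponent r *)
Definition weak_norm (s r : R) (g : 'rV[R]_n -> \bar R) : \bar R :=
  ereal_sup [set lebesgue R n E `^ (- r^-1 + (n%:R - s) / n%:R) *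
                 (\int[lebesgue R n]_(x in E) `|g x| `^ r) `^ r^-1
            | E in [set E : set (Rn R n) |
                    measurable E /\ 0 < lebesgue R n E < +oo]]%E.

End riesz.

(* Main.v *)
Require Import Defs.
From HB Require Import structures.
From mathcomp Require Import all_boot all_order all_algebra.
From mathcomp Require Import all_classical all_reals all_analysis.
From mathcomp Require Import measurable_realfun.
From mathcomp Require Import ring lra zify.

Set Implicit Arguments.
Unset Strict Implicit.
Unset Printing Implicit Defensive.

Import Order.TTheory GRing.Theory Num.Theory.
Import numFieldNormedType.Exports.

Local Open Scope classical_set_scope.
Local Open Scope ring_scope.

(** Write a = n - s, N = n / (n - a r), and v for the volume of the unit ball.
Both operators are controlled by the same positive kernel |x|^-a: the
function J f (x) = int |f(y)| |x - y|^-a dy satisfies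

  |I_s f| <= gamma_s J f    and    M_s f <= v^(-a/n) J f,

the second because |x - y|^-a >= rho^-a on the ball B(x, rho), whose volume
to the power a/n is v^(a/n) rho^a.  When f > 0 the first inequality is an
equality.  So the two upper bounds reduce to one estimate for J f, and the
two lower bounds to one estimate for functions that decay no faster than
|x|^-a.

Upper bound.  With respect to the weight |f(y)| dy, of total mass ||f||_1,
the convexity of t |-> t^r gives
  (J f)(x)^r <= ||f||_1^(r-1) int |f(y)| |x - y|^(-a r) dy.
Integrating over E and exchanging the integrals leaves the integral over E of
|x - y|^(-a r), which among all sets of measure |E| is largest for the ball
centered at y, because the kernel decreases with the distance to y.  On that
ball it is v^(a r/n) |E|^(1 - a r/n) N, and the powers of |E| cancel against
the normalisation of the weak norm (weak_norm_le_of_majorant).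

Lower bound.  For every radius L, both M_s f and J f (for f > 0, I_s f) are at
least a constant times (|x| + L)^-a int_{B(0,L)} |f|: a ball of radius
|x| + L centered at x contains B(0,L), and |x - y| <= |x| + L there.  On
large balls the shift by L is negligible, so that testing the weak norm on
B(0, rho) with rho -> oo recovers the value of the pure power |x|^-a
(weak_norm_ge_decay); then L -> oo recovers the full norm of f
(weak_norm_ge_of_minorant).

The integral of |x|^-b over the unit ball is found without polar coordinates.
Call it A.  The dilation x |-> l x turns the integral over B(0,l) into
l^(n-b) A, so the shell l <= |x| < 1 carries A (1 - l^(n-b)); on the shell
|x|^-b lies between 1 and l^-b, and the shell has volume v (1 - l^n).  Letting
l -> 1 gives A (n - b) = v n.

All this rests on basic facts on the Lebesgue measure of R^n, proved from its
definition by coverings with boxes: it is multiplied by |l|^n under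
x |-> z + l x, half-spaces are measurable, and the unit cube has positive
measure. *)

(** * Lebesgue measure on R^n *)

(** The integral is a difference of suprema over simple functions, so it is
monotone for all functions.  In this form it applies to the maximal function
and the Riesz potential without a proof that they are measurable. *)
Lemma le_integral_pointwise d (T : measurableType d) (R : realType)
    (mu : {measure set T -> \bar R}) (D : set T) (f g : T -> \bar R) :
  (forall x, D x -> f x <= g x)%E ->
  (\int[mu]_(x in D) f x <= \int[mu]_(x in D) g x)%E.
Proof.
move=> fg; rewrite /integral.
have fgD x : ((f \_ D) x <= (g \_ D) x)%E.
  by rewrite /patch; case: ifPn => // /[!inE]; exact: fg.
apply: leeB; apply: ge_ereal_sup => _ [h /= hf <-];
  apply: ereal_sup_ubound; exists h => //= x.
  by rewrite (le_trans (hf x))// !funeposE ge_max le_max fgD/= le_max lexx orbT.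
by rewrite (le_trans (hf x))// !funenegE ge_max le_max leeN2 fgD/= le_max lexx orbT.
Qed.

(** The unit cube is not covered by countably many boxes of total volume less
than 1.  The proof slices instead of using compactness: the boxes that meet the hyperplane where the
last coordinate is x cover a cube of one dimension less, so the
(n-1)-dimensional volumes of these slices add up to at least 1; integrating
over x in [0, 1] multiplies each slice by at most the last side of its box. *)
Lemma cube_cover_ge1 (R : realType) n (D : set nat) (a b : nat -> nat -> R) :
  (forall t : nat -> R, (forall i, (i < n)%N -> 0 <= t i <= 1) ->
    exists2 k, D k & forall i, (i < n)%N -> a k i <= t i <= b k i) ->
  (1 <= \sum_(k <oo)
         (\1_D k * \prod_(i < n) Num.max 0 (b k i - a k i))%:E :> \bar R)%E.
Proof.
elim: n D => [|n IH] D cov.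
  have [k Dk _] := cov (fun=> 0) (fun i i0 => ltac:(by [])).
  rewrite (@nneseriesD1 _ _ k)//; last first.
    by move=> i _; rewrite lee_fin big_ord0 mulr1.
  rewrite big_ord0 mulr1 indicE mem_set// leeDl//.
  by apply: nneseries_ge0 => i _ _; rewrite lee_fin big_ord0 mulr1.
pose v k : R := \prod_(i < n) Num.max 0 (b k i - a k i).
have v0 k : 0 <= v k by apply: prodr_ge0 => i _; rewrite le_max lexx.
pose I k : set (measurableTypeR R) := `[a k n, b k n]%classic.
pose mu := @lebesgue_measure R.
pose U : set (measurableTypeR R) := `[0, 1]%classic.
have slice (x : measurableTypeR R) : U x ->
    (1 <= \sum_(k <oo) (\1_D k * v k * \1_(I k) x)%:E)%E.
  rewrite /U/= in_itv/= => x01.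
  have -> : (\sum_(k <oo) (\1_D k * v k * \1_(I k) x)%:E =
    \sum_(k <oo) (\1_(D `&` [set k | I k x]) k * v k)%:E)%E.
    apply: eq_eseriesr => k _; congr EFin.
    by rewrite indicI mulrAC; congr (_ * _ * _).
  (* Extend a point of the smaller cube by the last coordinate x. *)
  apply: IH => t t01.
  have [|k Dk kt] := cov (fun i => if (i < n)%N then t i else x).
    by move=> i _; case: ifPn => // /t01.
  exists k; last first.
    by move=> i ni; have := kt i (leqW ni); rewrite ni.
  by split => //; have := kt n (ltnSn n); rewrite ltnn /I/= in_itv.
have m01 : mu U = 1%E.
  by rewrite /mu /U lebesgue_measure_itv/= lte_fin ltr01 oppr0 adde0.
have mU : measurable U by exact: measurable_itv.
have mI k : measurable (I k) by exact: measurable_itv.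
apply: (@le_trans _ _ (\int[mu]_(x in U)
    \sum_(k <oo) (\1_D k * v k * \1_(I k) x)%:E)%E).
  apply: (@le_trans _ _ (\int[mu]_(x in U) 1%:E)%E).
    by rewrite integral_cst// mul1e [leRHS]m01.
  by apply: le_integral_pointwise => x; exact: slice.
rewrite integral_nneseries//=; last 2 first.
- move=> k; apply/measurable_EFinP; apply: measurable_funM.
    exact: measurable_cst.
  exact: measurable_indic.
- by move=> k x _; rewrite lee_fin !mulr_ge0.
apply: lee_nneseries => k _.
  by move=> _; apply: integral_ge0 => x _; rewrite lee_fin !mulr_ge0.
under eq_integral do rewrite EFinM.
rewrite ge0_integralZl//; last 2 first.
- by apply/measurable_EFinP; exact: measurable_indic.
- by rewrite lee_fin mulr_ge0.
rewrite big_ord_recr/= mulrA -/(v k) [leRHS]EFinM; apply: lee_wpmul2l.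
  by rewrite lee_fin mulr_ge0.
rewrite integral_indic// (le_trans (le_measure _ _ _ (@subIsetl _ _ _)))//.
- by rewrite inE; apply: measurableI.
- by rewrite inE.
rewrite [leLHS](lebesgue_measure_itv `[a k n, b k n])/= lte_fin; case: ifPn => _.
  by rewrite -EFinD lee_fin le_max lexx orbT.
by rewrite lee_fin le_max lexx.
Qed.

Section affine.
Context (R : realType) (n : nat).
Local Notation outer := (@lebesgue_outer R n).

Definition affine (a : 'rV[R]_n) (l : R) (x : 'rV[R]_n) : 'rV[R]_n := a + l *: x.

Lemma affineK a l : l != 0 -> cancel (affine a l) (affine (- l^-1 *: a) l^-1).
Proof.
move=> l0 x; rewrite /affine scalerDr scalerA mulVf// scale1r addrA.
by rewrite scaleNr addNr add0r.
Qed.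

Lemma affineVK a l : l != 0 -> cancel (affine (- l^-1 *: a) l^-1) (affine a l).
Proof.
move=> l0 x; rewrite /affine scalerDr !scalerA mulrN mulfV// scaleN1r scale1r.
by rewrite addrA subrr add0r.
Qed.

Lemma preimage_affine a l (A : set 'rV[R]_n) : l != 0 ->
  affine a l @^-1` A = affine (- l^-1 *: a) l^-1 @` A.
Proof.
move=> l0; apply/seteqP; split => x /=.
  by move=> Ax; exists (affine a l x) => //; rewrite affineK.
by move=> [y Ay <-]; rewrite affineVK.
Qed.

(** A negative ratio exchanges the two corners of the box. *)
Definition affine_box a l (c : 'rV[R]_n * 'rV[R]_n) :=
  if 0 < l then (affine a l c.1, affine a l c.2)
  else (affine a l c.2, affine a l c.1).

Lemma box_vol_affine a l c : l != 0 ->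
  box_vol (affine_box a l c) = `|l| ^+ n * box_vol c.
Proof.
move=> l0; rewrite /box_vol -[X in _ ^+ X](card_ord n) -prodr_const -big_split/=.
apply: eq_bigr => i _; rewrite maxr_pMr// mulr0 /affine_box; case: ltgtP l0 => // l0 _;
  congr (Num.max 0 _); rewrite /= /affine !mxE.
  by rewrite gtr0_norm//; ring.
by rewrite ltr0_norm//; ring.
Qed.

Lemma affine_in_box a l c : l != 0 -> affine a l @` box c `<=` box (affine_box a l c).
Proof.
move=> l0 _ [x cx <-] i; have /andP[ci1 ci2] := cx i.
rewrite /affine_box; case: ltgtP l0 => // l0 _ /=; rewrite /affine !mxE !lerD2l.
  by rewrite !ler_pM2l// ci1 ci2.
by rewrite !ler_nM2l// ci1 ci2.
Qed.

Lemma lebesgue_outer_affine_le a l A : l != 0 ->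
  (outer (affine a l @` A) <= (`|l| ^+ n)%:E * outer A)%E.
Proof.
move=> l0; have ln0 : 0 < `|l| ^+ n by rewrite exprn_gt0// normr_gt0.
rewrite -lee_pdivrMl//; apply: le_ereal_inf_tmp => _ [F FA <-].
rewrite lee_pdivrMl//; apply: ereal_inf_lbound.
exists (F.1, fun k => affine_box a l (F.2 k)).
  move=> _ [x /FA[k Fk Bx] <-]; exists k => //=.
  by apply: affine_in_box => //; exists x.
rewrite /= -(set_mem_set F.1) -!nneseries_esum; last 2 first.
- by move=> k _; rewrite lee_fin box_vol_ge0.
- by move=> k _; rewrite lee_fin box_vol_ge0.
rewrite -nneseriesZl; last by move=> k _; rewrite lee_fin box_vol_ge0.
by apply: eq_eseriesr => k _; rewrite box_vol_affine// EFinM.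
Qed.

(** The inequality applied to the inverse map gives the converse one. *)
Lemma lebesgue_outer_affine a l A : l != 0 ->
  outer (affine a l @` A) = ((`|l| ^+ n)%:E * outer A)%E.
Proof.
move=> l0; have ln0 : 0 < `|l| ^+ n by rewrite exprn_gt0// normr_gt0.
apply/eqP; rewrite eq_le lebesgue_outer_affine_le//=.
rewrite -lee_pdivlMl//.
have := @lebesgue_outer_affine_le (- l^-1 *: a) l^-1 (affine a l @` A).
rewrite normfV exprVn invr_eq0 => /(_ l0); apply: le_trans.
rewrite image_comp (_ : _ \o _ = id) ?image_id//.
by apply/funext => x /=; rewrite affineK.
Qed.

Lemma lebesgue_outer_preimage_affine a l A : l != 0 ->
  outer (affine a l @^-1` A) = ((`|l| ^- n)%:E * outer A)%E.
Proof.
move=> l0; rewrite preimage_affine// lebesgue_outer_affine ?invr_eq0//.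
by rewrite normfV exprVn.
Qed.

Lemma measurable_affine a l : l != 0 ->
  measurable_fun setT (affine a l : Rn R n -> Rn R n).
Proof.
move=> l0 _ B mB; rewrite setTI.
have {}mB : caratheodory_measurable outer B := mB.
suff : caratheodory_measurable outer (affine a l @^-1` B) by [].
move=> X.
have ln0 : 0 < `|l| ^+ n by rewrite exprn_gt0// normr_gt0.
have E Y : outer (X `&` affine a l @^-1` Y) =
    ((`|l| ^- n)%:E * outer ((affine a l @` X) `&` Y))%E.
  rewrite -(lebesgue_outer_preimage_affine a)// preimage_setI; congr (outer (_ `&` _)).
  apply/seteqP; split => x /=; first by exists x.
  by move=> [y Xy /(can_inj (affineK a l0)) <-].
rewrite preimage_setC !E -ge0_muleDr ?lebesgue_outer_ge0// -(mB (affine a l @` X)).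
by have := E setT; rewrite preimage_setT !setIT.
Qed.

End affine.
Section half_spaces.
Context (R : realType) (n : nat).
Local Notation outer := (@lebesgue_outer R n).
Implicit Types (c : 'rV[R]_n * 'rV[R]_n) (i : 'I_n).

Definition box_below i (t : R) c : 'rV[R]_n * 'rV[R]_n :=
  (c.1, \row_j (if j == i then Num.min (c.2 0 j) t else c.2 0 j)).

Definition box_above i (t : R) c : 'rV[R]_n * 'rV[R]_n :=
  (\row_j (if j == i then Num.max (c.1 0 j) t else c.1 0 j), c.2).

(** Exact also when the hyperplane misses the box: one of the two parts then
has a nonpositive side, which counts as 0. *)
Lemma box_vol_split i t c :
  box_vol c = box_vol (box_below i t c) + box_vol (box_above i t c).
Proof.
rewrite /box_vol (bigD1 i)//= [in X in _ = X + _](bigD1 i)//=.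
rewrite [in X in _ = _ + X](bigD1 i)//= !mxE eqxx.
under [in X in _ = _ * X + _]eq_bigr => j ji do rewrite mxE (negbTE ji).
under [in X in _ = _ + _ * X]eq_bigr => j ji do rewrite mxE (negbTE ji).
rewrite -mulrDl; congr (_ * _).
by rewrite /Num.max /Num.min; do !case: ifPn; lra.
Qed.

(** Cutting each box of a covering along the hyperplane gives coverings of both
parts without changing the total volume. *)
Lemma half_space_caratheodory i t : outer.-caratheodory [set x | x 0 i <= t].
Proof.
apply: le_caratheodory_measurable => X; apply: le_ereal_inf_tmp => _ [F FX <-].
have vol0 c : (0 <= (box_vol c)%:E)%E by rewrite lee_fin box_vol_ge0.
under eq_esum do rewrite (box_vol_split i t) EFinD.
rewrite esumD//; apply: leeD; apply: ereal_inf_lbound.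
- exists (F.1, fun k => box_below i t (F.2 k)) => // x [/FX[k Fk Bx] /= xt].
  exists k => //= j; rewrite mxE; have /andP[B1 B2] := Bx j.
  by rewrite B1; case: eqP => [ji|//]; rewrite le_min B2 ji.
- exists (F.1, fun k => box_above i t (F.2 k)) => // x [/FX[k Fk Bx] /= /negP xt].
  exists k => //= j; rewrite mxE; have /andP[B1 B2] := Bx j.
  by rewrite B2 andbT; case: eqP => [ji|//]; rewrite ge_max B1 ji ltW// ltNge.
Qed.

Lemma measurable_coord i : measurable_fun setT (fun x : Rn R n => x 0 i).
Proof.
move=> mD; apply: (measurability _ (RGenOInfty.measurableE R)) => //.
move=> _ [_ [t ->] <-]; rewrite setTI.
have -> : (fun x : Rn R n => x 0 i) @^-1` `]t, +oo[%classic =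
    ~` [set x : Rn R n | x 0 i <= t].
  by apply/seteqP; split => x /=; rewrite in_itv/= andbT ltNge => /negP.
exact/measurableC/half_space_caratheodory.
Qed.

End half_spaces.

Section euclidean_norm.
Context (R : realType) (n : nat).
Implicit Types x y z : 'rV[R]_n.

Lemma enorm_ge0 x : 0 <= enorm x.
Proof. exact: sqrtr_ge0. Qed.

Lemma sqr_enorm x : enorm x ^+ 2 = \sum_(i < n) x 0 i ^+ 2.
Proof. by rewrite sqr_sqrtr// sumr_ge0// => i _; rewrite sqr_ge0. Qed.

Lemma enormZ (l : R) x : enorm (l *: x) = `|l| * enorm x.
Proof.
rewrite /enorm -sqrtr_sqr -sqrtrM ?sqr_ge0//; congr Num.sqrt.
by rewrite mulr_sumr; apply: eq_bigr => i _; rewrite mxE exprMn.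
Qed.

Lemma enormN x : enorm (- x) = enorm x.
Proof. by rewrite -scaleN1r enormZ normrN1 mul1r. Qed.

Lemma enorm0 : enorm (0 : 'rV[R]_n) = 0.
Proof. by rewrite -(scale0r (0 : 'rV[R]_n)) enormZ normr0 mul0r. Qed.

Lemma coord_le_enorm x i : `|x 0 i| <= enorm x.
Proof.
rewrite -sqrtr_sqr /enorm ler_sqrt ?sumr_ge0// => [|j _]; last exact: sqr_ge0.
by rewrite (bigD1 i)//= lerDl sumr_ge0// => j _; exact: sqr_ge0.
Qed.

Lemma enorm_eq0 x : (enorm x == 0) = (x == 0).
Proof.
apply/eqP/eqP => [x0|->]; last exact: enorm0.
apply/rowP => i; rewrite mxE; apply/eqP; rewrite -normr_le0.
by rewrite -x0 coord_le_enorm.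
Qed.

Lemma enorm_gt0 x : (0 < enorm x) = (x != 0).
Proof. by rewrite lt_neqAle enorm_ge0 andbT eq_sym enorm_eq0. Qed.

Lemma cauchy_schwarz x y : \sum_(i < n) x 0 i * y 0 i <= enorm x * enorm y.
Proof.
have [/eqP|x0] := eqVneq (enorm x) 0.
  rewrite enorm_eq0 => /eqP ->; rewrite enorm0 mul0r.
  by rewrite big1// => i _; rewrite mxE mul0r.
have [/eqP|y0] := eqVneq (enorm y) 0.
  rewrite enorm_eq0 => /eqP ->; rewrite enorm0 mulr0.
  by rewrite big1// => i _; rewrite mxE mulr0.
have xy0 : 0 < enorm x * enorm y by rewrite mulr_gt0// lt_neqAle eq_sym ?x0 ?y0 enorm_ge0.
have : 0 <= \sum_(i < n) (enorm y * x 0 i - enorm x * y 0 i) ^+ 2.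
  by apply: sumr_ge0 => i _; exact: sqr_ge0.
have -> : \sum_(i < n) (enorm y * x 0 i - enorm x * y 0 i) ^+ 2 =
    2 * (enorm x * enorm y) * (enorm x * enorm y - \sum_(i < n) x 0 i * y 0 i).
  transitivity (enorm y ^+ 2 * \sum_(i < n) x 0 i ^+ 2 +
    enorm x ^+ 2 * \sum_(i < n) y 0 i ^+ 2 -
    2 * (enorm x * enorm y) * \sum_(i < n) x 0 i * y 0 i).
    rewrite !mulr_sumr -big_split/= -sumrB; apply: eq_bigr => i _; ring.
  rewrite -!sqr_enorm; ring.
by rewrite pmulr_rge0 ?subr_ge0// mulr_gt0.
Qed.

Lemma ler_enormD x y : enorm (x + y) <= enorm x + enorm y.
Proof.
rewrite -(@ler_pXn2r _ 2)// ?nnegrE ?addr_ge0 ?enorm_ge0//.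
rewrite sqr_enorm.
have -> : \sum_(i < n) (x + y) 0 i ^+ 2 =
    enorm x ^+ 2 + enorm y ^+ 2 + 2 * \sum_(i < n) x 0 i * y 0 i.
  rewrite !sqr_enorm mulr_sumr -!big_split/=; apply: eq_bigr => i _.
  by rewrite mxE; ring.
have := cauchy_schwarz x y; lra.
Qed.

(** Stated for a map from an arbitrary measurable space, so as to apply both to
y |-> y - x on R^n and to (x, y) |-> x - y on the product of two copies. *)
Lemma measurable_enorm d (T : measurableType d) (h : T -> 'rV[R]_n) :
  (forall i, measurable_fun setT (fun t => h t 0 i)) ->
  measurable_fun setT (fun t => enorm (h t)).
Proof.
move=> mh; apply: (measurableT_comp (f := @Num.sqrt R)).
  by apply: continuous_measurable_fun => r; exact: sqrt_continuous.
by apply: measurable_sum => i; exact: measurable_funX.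
Qed.

Lemma measurable_enormB (x : 'rV[R]_n) :
  measurable_fun setT (fun y : Rn R n => enorm (y - x)).
Proof.
apply: measurable_enorm => i.
under eq_fun do rewrite !mxE.
by apply: measurable_funB => //; exact: measurable_coord.
Qed.

Lemma measurable_eball x rho : measurable (eball x rho).
Proof.
rewrite -[eball _ _]setTI.
have -> : eball x rho = (fun y : Rn R n => enorm (y - x)) @^-1` `]-oo, rho[%classic.
  by apply/seteqP; split => y /=; rewrite in_itv.
exact: measurable_enormB.
Qed.

End euclidean_norm.
Section ball_volume.
Context (R : realType) (n : nat).
Local Notation outer := (@lebesgue_outer R n).
Local Notation mu := (lebesgue R n).
Implicit Types (x y : 'rV[R]_n).

Lemma lebesgue_outer_box_le c : (outer (box c) <= (box_vol c)%:E)%E.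
Proof.
apply: ereal_inf_lbound; exists ([set 0%N], fun=> c); first by exists 0%N.
by rewrite esum_set1// lee_fin box_vol_ge0.
Qed.

Definition unit_cube : set 'rV[R]_n := [set x | forall i, 0 <= x 0 i <= 1].

Lemma lebesgue_outer_cube_ge1 : (1 <= outer unit_cube)%E.
Proof.
apply: le_ereal_inf_tmp => _ [F FC <-].
(* Corners as sequences indexed by nat, continued by 0. *)
pose e (v : 'rV[R]_n) i := oapp (fun j : 'I_n => v 0 j) 0 (insub i).
have eE v (j : 'I_n) : e v j = v 0 j by rewrite /e valK.
have := @cube_cover_ge1 R n F.1 (fun k => e (F.2 k).1) (fun k => e (F.2 k).2).
rewrite esum_mkcond -nneseries_esumT; last first.
  by move=> k; case: ifPn => // _; rewrite lee_fin box_vol_ge0.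
rewrite (@eq_eseriesr _ (fun k => (\1_F.1 k * _)%:E)
  (fun k => if k \in F.1 then (box_vol (F.2 k))%:E else 0%E)); last first.
  move=> k _; under eq_bigr do rewrite !eE.
  by rewrite indicE; case: ifP; rewrite ?mul1r ?mul0r.
apply => t t01.
have [|k Fk Bk] := FC (\row_(j < n) t j).
  by move=> i; rewrite mxE t01.
exists k => // i ni; have := Bk (Ordinal ni).
by rewrite mxE -!eE.
Qed.

Lemma eballE x rho : 0 < rho -> eball x rho = affine x rho @` eball 0 1.
Proof.
move=> r0; apply/seteqP; split => y /=; rewrite /eball/=.
  move=> yx; exists (rho^-1 *: (y - x)).
    by rewrite subr0 enormZ gtr0_norm ?invr_gt0// mulrC ltr_pdivrMr// mul1r.
  by rewrite /affine scalerA divff ?gt_eqF// scale1r addrC subrK.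
move=> [z z1 <-]; rewrite /affine addrC addKr enormZ gtr0_norm//.
by rewrite subr0 in z1; rewrite gtr_pMr.
Qed.

Lemma lebesgue_eball_scale x rho : 0 < rho ->
  mu (eball x rho) = ((rho ^+ n)%:E * mu (eball 0 1))%E.
Proof.
by move=> r0; rewrite eballE// [LHS]lebesgue_outer_affine ?gt_eqF// gtr0_norm.
Qed.

Lemma lebesgue_unit_ball_lty : (mu (eball 0 1) < +oo)%E.
Proof.
apply: (@le_lt_trans _ _ (outer (box (const_mx (-1), const_mx 1)))).
  apply: le_lebesgue_outer => x /=; rewrite /eball/= subr0 => x1 i /=.
  by rewrite !mxE -ler_norml (le_trans (coord_le_enorm _ _))// ltW.
by rewrite (le_lt_trans (lebesgue_outer_box_le _))// ltry.
Qed.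

Lemma lebesgue_unit_ball : mu (eball 0 1) = (unit_ball_vol R n)%:E.
Proof.
by rewrite fineK// ge0_fin_numE ?lebesgue_unit_ball_lty//; exact: lebesgue_outer_ge0.
Qed.

(** The unit cube lies in a dilate of the unit ball, of measure (n+1)^n v. *)
Lemma unit_ball_vol_gt0 : 0 < unit_ball_vol R n.
Proof.
rewrite lt_neqAle; apply/andP; split; last first.
  by rewrite fine_ge0//; exact: lebesgue_outer_ge0.
apply/negP => /eqP v0.
suff : (outer unit_cube <= 0)%E.
  by apply/negP; rewrite -ltNge (lt_le_trans _ lebesgue_outer_cube_ge1)// lte_fin.
have <- : mu (eball 0 n.+1%:R) = 0%E.
  by rewrite lebesgue_eball_scale// lebesgue_unit_ball -v0 mule0.
apply: le_lebesgue_outer => x x01; rewrite /eball/= subr0.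
rewrite -(@ltr_pXn2r _ 2)// ?nnegrE ?enorm_ge0// sqr_enorm.
apply: (@le_lt_trans _ _ (\sum_(i < n) 1)).
  apply: ler_sum => i _; have /andP[xi0 xi1] := x01 i.
  by rewrite expr_le1.
by rewrite sumr_const card_ord -natrX ltr_nat; lia.
Qed.

Lemma lebesgue_eball x rho : 0 < rho ->
  mu (eball x rho) = (unit_ball_vol R n * rho ^+ n)%:E.
Proof.
by move=> r0; rewrite lebesgue_eball_scale// lebesgue_unit_ball -EFinM mulrC.
Qed.

Lemma lebesgue_sigma_finite : sigma_finite setT mu.
Proof.
exists (fun k => eball 0 k.+1%:R); last first.
  by move=> k; split; [exact: measurable_eball|rewrite lebesgue_eball// ltry].
apply/esym/seteqP; split => // x _.
exists (Num.truncn (enorm x)) => //=; rewrite /eball/= subr0.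
exact: truncnS_gt.
Qed.

HB.instance Definition _ :=
  @Measure_isSigmaFinite.Build _ _ _ mu lebesgue_sigma_finite.

Lemma lebesgue_set1 x : (0 < n)%N -> mu [set x] = 0%E.
Proof.
move=> n0; apply/eqP; rewrite eq_le; apply/andP; split; last exact: lebesgue_outer_ge0.
have -> : [set x] = box (x, x).
  apply/seteqP; split => y /=; first by move=> -> i /=; rewrite lexx.
  by move=> xy; apply/rowP => i; apply/esym/eqP; rewrite eq_le.
rewrite (le_trans (lebesgue_outer_box_le _))// /box_vol/= lee_fin.
by rewrite (bigD1 (Ordinal n0))//= subrr maxxx mul0r.
Qed.

(** Change of variables: the image of the measure under the affine map is
|l|^-n times the measure. *)
Lemma ge0_integral_affine a (l : R) (D : set (Rn R n)) (g : Rn R n -> \bar R) :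
  l != 0 -> measurable D -> measurable_fun D g -> (forall x, 0 <= g x)%E ->
  (\int[mu]_(x in affine a l @^-1` D) g (affine a l x) =
   (`|l| ^- n)%:E * \int[mu]_(x in D) g x)%E.
Proof.
move=> l0 mD mg g0.
rewrite -[LHS](ge0_integral_pushforward (measurable_affine a l0))//.
have ln0 : 0 <= `|l| ^- n by rewrite invr_ge0 exprn_ge0.
rewrite -(@ge0_integral_mscale _ _ _ mu D mD (NngNum ln0))//.
apply: eq_measure_integral => [|mphi A mA _]; first exact: measurable_affine.
exact: (@lebesgue_outer_preimage_affine R n a l A l0).
Qed.

End ball_volume.
(** * The integral of a power of the norm over balls *)

(** Lets t -> 0+, the form in which the limit l -> 1 of a shell is taken, with
l = exp (- t).  The witness is the t for which exp (c t) = (X + Y) / (2 Y). *)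
Lemma ler_of_ler_expR (R : realType) (c X Y : R) : 0 <= c -> 0 <= Y ->
  (forall t, 0 < t -> X <= Y * expR (c * t)) -> X <= Y.
Proof.
move=> c0 Y0 XY; rewrite leNgt; apply/negP => YX.
have X0 : 0 < X by exact: le_lt_trans YX.
have [c00|cn0] := eqVneq c 0.
  have := XY 1 ltr01; rewrite c00 mul0r expR0 mulr1; lra.
have [Y00|Yn0] := eqVneq Y 0.
  have := XY 1 ltr01; rewrite Y00 mul0r; lra.
have cp : 0 < c by rewrite lt_neqAle eq_sym cn0.
have Yp : 0 < Y by rewrite lt_neqAle eq_sym Yn0.
have q0 : 0 < (X + Y) / (2 * Y) by rewrite divr_gt0 ?addr_gt0 ?mulr_gt0.
have q1 : 1 < (X + Y) / (2 * Y) by rewrite ltr_pdivlMr ?mulr_gt0//; lra.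
have := XY (ln ((X + Y) / (2 * Y)) / c); rewrite divr_gt0 ?ln_gt0// => /(_ isT).
rewrite mulrCA divff// mulr1 lnK ?posrE//.
have -> : Y * ((X + Y) / (2 * Y)) = (X + Y) / 2.
  by field; rewrite ?Yn0.
lra.
Qed.

Section riesz_kernel.
Context (R : realType) (n : nat).
Local Notation mu := (lebesgue R n).
Local Notation vn := (unit_ball_vol R n).
Implicit Types (x y : 'rV[R]_n) (b : R).

(** The power |x|^-b.  At x = 0 it has the value 0 (for b <> 0) instead of
being infinite, which is harmless for integrals when n > 0 but restricts
pointwise lower bounds to x <> 0. *)
Definition riesz_kernel b x : R := enorm x `^ (- b).
Local Notation k := riesz_kernel.

Lemma riesz_kernel_ge0 b x : 0 <= k b x.
Proof. exact: powR_ge0. Qed.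

Lemma riesz_kernelN b x : k b (- x) = k b x.
Proof. by rewrite /k enormN. Qed.

Lemma riesz_kernelZ b (l : R) x : 0 < l -> k b (l *: x) = l `^ (- b) * k b x.
Proof. by move=> l0; rewrite /k enormZ gtr0_norm// powRM ?enorm_ge0// ltW. Qed.

Lemma riesz_kernelX b (r : R) x : k b x `^ r = k (b * r) x.
Proof. by rewrite /k -powRrM mulNr. Qed.

Lemma powRN_anti b (s t : R) : 0 <= b -> 0 < s -> s <= t -> t `^ (- b) <= s `^ (- b).
Proof.
move=> b0 s0 st; rewrite !powRN lef_pV2 ?posrE ?powR_gt0//; last exact: lt_le_trans st.
by apply: ge0_ler_powR => //; rewrite nnegrE ltW// (lt_le_trans s0).
Qed.

Lemma measurable_riesz_kernel b y :
  measurable_fun setT (fun x : Rn R n => k b (x - y)).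
Proof.
apply: (measurableT_comp (f := @powR R ^~ (- b))); first exact: measurable_powR.
exact: measurable_enormB.
Qed.

Lemma measurable_riesz_kernelE b y (D : set (Rn R n)) :
  measurable_fun D (fun x : Rn R n => (k b (x - y))%:E).
Proof.
apply/measurable_funTS/measurable_EFinP.
exact: measurable_riesz_kernel.
Qed.

Lemma ae_neq y : (0 < n)%N -> {ae mu, forall x : Rn R n, x <> y}.
Proof.
move=> n0; exists [set y]; split.
- have -> : [set y] = [set x | enorm (x - y) = 0].
    apply/seteqP; split => x /=; first by move=> ->; rewrite subrr enorm0.
    by move/eqP; rewrite enorm_eq0 subr_eq0 => /eqP.
  rewrite -[X in measurable X]setTI.
  exact: (measurable_enormB y measurableT (measurable_set1 0)).
- exact: lebesgue_set1.
- by move=> x /= /contrapT.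
Qed.

Lemma measurable_shell y (s t : R) : measurable (eball y s `\` eball y t).
Proof. by apply: measurableD; exact: measurable_eball. Qed.

Lemma integral_riesz_kernel_dilate b (l : R) (D : set (Rn R n)) : 0 < l ->
  measurable D ->
  (\int[mu]_(x in affine (0 : 'rV[R]_n) l @^-1` D) (k b (x - 0))%:E =
   (l `^ (b - n%:R))%:E * \int[mu]_(x in D) (k b (x - 0))%:E)%E.
Proof.
move=> l0 mD.
have := @ge0_integral_affine R n 0 l D (fun x => (k b (x - 0))%:E).
move=> /(_ (lt0r_neq0 l0) mD (@measurable_riesz_kernelE b 0 D)) H.
rewrite powRB ?(gt_eqF l0) ?implybT// powR_mulrn ?ltW// EFinM -muleA.
rewrite gtr0_norm// in H; rewrite -H; last by move=> x; rewrite lee_fin riesz_kernel_ge0.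
rewrite -ge0_integralZl//; last 4 first.
- rewrite -[X in measurable X]setTI; exact: measurable_affine (lt0r_neq0 l0) measurableT _ mD.
- apply/measurable_funTS/(measurableT_comp (@measurable_riesz_kernelE b 0 setT)).
  exact: measurable_affine (lt0r_neq0 l0).
- by move=> x _; rewrite lee_fin riesz_kernel_ge0.
- by rewrite lee_fin powR_ge0.
apply: eq_integral => x _; rewrite /affine add0r !subr0 riesz_kernelZ// -EFinM.
by rewrite mulrA -powRD ?subrr ?powRr0 ?mul1r// (gt_eqF l0) implybT.
Qed.

End riesz_kernel.
Section integral_riesz_kernel.
Context (R : realType) (n : nat) (b : R).
Hypotheses (b0 : 0 < b) (bn : b < n%:R).
Local Notation mu := (lebesgue R n).
Local Notation vn := (unit_ball_vol R n).
Local Notation k := (@riesz_kernel R n).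
Local Notation B := (@eball R n 0).

Let n_gt0 : (0 < n)%N.
Proof. by rewrite -(@ltr_nat R) (lt_trans b0). Qed.

Let k_ge0 (x : 'rV[R]_n) : (0 <= (k b x)%:E)%E.
Proof. by rewrite lee_fin riesz_kernel_ge0. Qed.

Lemma preimage_dilate_ball (l t : R) : 0 < l ->
  affine (0 : 'rV[R]_n) l @^-1` B (l * t) = B t.
Proof.
move=> l0; apply/seteqP; split => x;
  by rewrite /eball/= /affine add0r !subr0 enormZ gtr0_norm// ltr_pM2l.
Qed.

Lemma integral_riesz_kernel_scale (l : R) (D : set (Rn R n)) : 0 < l ->
  measurable D ->
  (\int[mu]_(x in D) (k b (x - 0))%:E = (l `^ (n%:R - b))%:E *
   \int[mu]_(x in affine (0 : 'rV[R]_n) l @^-1` D) (k b (x - 0))%:E)%E.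
Proof.
move=> l0 mD; rewrite integral_riesz_kernel_dilate// muleA -EFinM -powRD.
  by rewrite addrA subrK subrr powRr0 mul1e.
by rewrite (gt_eqF l0) implybT.
Qed.

Lemma lebesgue_shell (l : R) : 0 < l < 1 ->
  mu (B 1 `\` B l) = (vn * (1 - l ^+ n))%:E.
Proof.
move=> /andP[l0 l1]; rewrite measureD; last 3 first.
- exact: measurable_eball.
- exact: measurable_eball.
- by rewrite [X in (X < _)%E]lebesgue_eball// ltry.
rewrite setIidr; last by move=> x; rewrite /eball/= => /lt_trans; exact.
rewrite [X in (X - _)%E]lebesgue_eball// [X in (_ - X)%E]lebesgue_eball//.
by rewrite -EFinB expr1n mulr1 mulrBr mulr1.
Qed.

Lemma integral_riesz_kernel_shell (l : R) : 0 < l < 1 ->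
  ((vn * (1 - l ^+ n))%:E <= \int[mu]_(x in B 1 `\` B l) (k b (x - 0))%:E <=
   (l `^ (- b) * (vn * (1 - l ^+ n)))%:E)%E.
Proof.
move=> l01; have /andP[l0 l1] := l01.
have mS : measurable (B 1 `\` B l) by exact: measurable_shell.
apply/andP; split.
  rewrite -lebesgue_shell// -[leLHS]mul1e -integral_cst//.
  apply: le_integral_pointwise => x []; rewrite /eball/= subr0 => x1 /negP.
  rewrite -leNgt => lx; have one_powR : 1 = 1 `^ (- b) :> R by rewrite powR1.
  rewrite lee_fin [leLHS]one_powR.
  by apply: powRN_anti; [exact: ltW|exact: lt_le_trans lx|exact: ltW].
rewrite EFinM -lebesgue_shell// -integral_cst//.
apply: le_integral_pointwise => x []; rewrite /eball/= subr0 => x1 /negP.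
by rewrite -leNgt => lx; rewrite lee_fin; apply: powRN_anti => //; exact: ltW.
Qed.

(** Finiteness must precede the computation, since A = S + q A also holds for
A = +oo.  With l = 1/2, S the integral over the shell l <= |x| < 1 and
q = l^(n-b) < 1, the integral over l^j <= |x| < 1 is at most S + q times the
one for j - 1, hence stays below S / (1 - q). *)
Lemma integral_riesz_kernel_ball_lty : (\int[mu]_(x in B 1) (k b (x - 0))%:E < +oo)%E.
Proof.
pose l : R := 2^-1.
have l01 : 0 < l < 1 by rewrite /l; lra.
have /andP[l0 l1] := l01.
pose q := l `^ (n%:R - b).
have q1 : q < 1.
  have one_powR : 1 = 1 `^ (n%:R - b) :> R by rewrite powR1.
  rewrite /q [ltRHS]one_powR; apply: gt0_ltr_powR; rewrite ?nnegrE ?ler01 ?subr_gt0//.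
  exact: ltW.
have q0 : 0 <= q by exact: powR_ge0.
pose s := l `^ (- b) * (vn * (1 - l ^+ n)).
have s0 : 0 <= s.
  rewrite mulr_ge0 ?powR_ge0// mulr_ge0 ?(ltW (unit_ball_vol_gt0 _ _))//.
  by rewrite subr_ge0 exprn_ile1// ltW.
pose F j := B 1 `\` B (l ^+ j).
have mF j : measurable (F j) by exact: measurable_shell.
have F_le j : (\int[mu]_(x in F j) (k b (x - 0))%:E <= (s / (1 - q))%:E)%E.
  elim: j => [|j IH].
    rewrite /F expr0 setDv integral_set0 lee_fin divr_ge0// subr_ge0; exact: ltW.
  have FS : F j.+1 `<=` (B 1 `\` B l) `|` (B l `\` B (l * l ^+ j)).
    move=> x []; rewrite exprS => Bx nBx.
    by have [Blx|nBlx] := pselect (B l x); [right|left].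
  have mU : measurable ((B 1 `\` B l) `|` (B l `\` B (l * l ^+ j))).
    by apply: measurableU; exact: measurable_shell.
  apply: le_trans (ge0_subset_integral mu (mF _) mU _ _ FS) _ => //.
    exact: measurable_riesz_kernelE.
  rewrite ge0_integral_setU//; last 4 first.
  - exact: measurable_shell.
  - exact: measurable_shell.
  - exact: measurable_riesz_kernelE.
  - by rewrite disj_set2E; apply/eqP/seteqP; split => // x [[_ nBx] [Bx _]].
  (* The bound s / (1 - q) is the fixed point of t |-> s + q t. *)
  have -> : (s / (1 - q))%:E = (s%:E + q%:E * (s / (1 - q))%:E)%E.
    by rewrite -EFinM -EFinD; congr EFin; field; lra.
  apply: leeD; first by have /andP[] := integral_riesz_kernel_shell l01.
  rewrite (integral_riesz_kernel_scale l0); last exact: measurable_shell.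
  rewrite (_ : _ @^-1` _ = F j).
    by apply: lee_wpmul2l; rewrite ?lee_fin.
  have pB1 : affine (0 : 'rV[R]_n) l @^-1` B l = B 1.
    by rewrite -(preimage_dilate_ball 1 l0) mulr1.
  have pBj := preimage_dilate_ball (l ^+ j) l0.
  by rewrite /F -pB1 -pBj.
have ndF : nondecreasing_seq F.
  apply/nondecreasing_seqP => j; apply/subsetPset => x [Bx nBx]; split => //.
  move=> Bjx; apply: nBx; move: Bjx; rewrite /eball/= => /lt_le_trans; apply.
  by rewrite exprS ler_piMl ?exprn_ge0// ltW.
have UF : \bigcup_j F j = B 1 `\` [set 0].
  apply/seteqP; split => x.
    move=> [j _ [Bx nBx]]; split => // /= x0; apply: nBx; rewrite x0 /eball/=.
    by rewrite subrr enorm0 exprn_gt0.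
  move=> [Bx /= /eqP x0]; pose j := (Num.truncn (enorm x)^-1).+1.
  exists j => //; split => //; rewrite /eball/= subr0; apply/negP.
  rewrite -leNgt /l exprVn invf_ple ?posrE ?enorm_gt0 ?exprn_gt0//.
  rewrite (le_trans (ltW (truncnS_gt _)))// -/j -natrX ler_nat ltnW//.
  exact: ltn_expl.
rewrite (@ge0_negligible_integral _ _ _ mu (B 1) [set 0])//; last 4 first.
- have -> : [set 0] = B 1 `\` \bigcup_j F j.
    rewrite UF; apply/seteqP; split => x /=.
      move=> ->; split; last by case.
      by rewrite /eball/= subrr enorm0.
    by move=> [Bx /not_andP[//|/contrapT]].
  apply: measurableD; first exact: measurable_eball.
  exact: bigcup_measurable.
- exact: measurable_eball.
- exact: measurable_riesz_kernelE.
- exact: lebesgue_set1.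
rewrite -UF.
have mk j : measurable_fun (F j) (fun x : Rn R n => (k b (x - 0))%:E).
  exact: measurable_riesz_kernelE.
have cvF := @ge0_nondecreasing_set_cvg_integral _ _ _ F _ mu ndF mF mk
  (fun _ _ _ => k_ge0 _).
apply: (@le_lt_trans _ _ (s / (1 - q))%:E); last exact: ltry.
rewrite -(cvg_lim _ cvF)//; apply: lime_le; first by apply/cvg_ex; eexists; exact: cvF.
exact: nearW.
Qed.

End integral_riesz_kernel.
Section integral_riesz_kernel_ball.
Context (R : realType) (n : nat) (b : R).
Hypotheses (b0 : 0 < b) (bn : b < n%:R).
Local Notation mu := (lebesgue R n).
Local Notation vn := (unit_ball_vol R n).
Local Notation k := (@riesz_kernel R n).

Let n_gt0 : (0 < n)%N.
Proof. by rewrite -(@ltr_nat R) (lt_trans b0). Qed.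

Let vn0 : 0 < vn := unit_ball_vol_gt0 R n.

Let k_ge0 (x : 'rV[R]_n) : (0 <= (k b x)%:E)%E.
Proof. by rewrite lee_fin riesz_kernel_ge0. Qed.

(** A (1 - l^(n-b)) is the integral over the shell l <= |x| < 1.  With
l = exp (- t), comparison with the volume of the shell and
c t exp (- c t) <= 1 - exp (- c t) <= c t give A (n - b) = v n up to a factor
exp (n t). *)
Lemma integral_riesz_kernel_unit_ball :
  (\int[mu]_(x in eball 0 1) (k b (x - 0))%:E = (vn * (n%:R / (n%:R - b)))%:E)%E.
Proof.
have Aoo := integral_riesz_kernel_ball_lty b0 bn.
set A := (X in (X < +oo)%E) in Aoo *.
have A0 : (0 <= A)%E by apply: integral_ge0 => x _; exact: k_ge0.
have : (fine A)%:E = A by rewrite fineK// ge0_fin_numE.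
set a := fine A => aE.
have a0 : 0 <= a by exact: fine_ge0.
have nb : 0 < n%:R - b by rewrite subr_gt0.
have shell (l : R) : 0 < l < 1 ->
    vn * (1 - l ^+ n) <= a * (1 - l `^ (n%:R - b)) <= l `^ (- b) * (vn * (1 - l ^+ n)).
  move=> l01; have /andP[l0 l1] := l01.
  have := integral_riesz_kernel_shell n b0 l01.
  suff -> : (\int[mu]_(x in eball 0 1 `\` eball 0 l) (k b (x - 0))%:E =
      (a * (1 - l `^ (n%:R - b)))%:E)%E by rewrite !lee_fin.
  have AE : (A = \int[mu]_(x in eball 0 1 `\` eball 0 l) (k b (x - 0))%:E +
      (l `^ (n%:R - b))%:E * A)%E.
    rewrite {1}/A -{1}(@setDUK _ (eball 0 l) (eball 0 1)); last first.
      by move=> x; rewrite /eball/= => /lt_trans; exact.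
    rewrite ge0_integral_setU//; last 4 first.
    - exact: measurable_eball.
    - exact: measurable_shell.
    - exact: measurable_riesz_kernelE.
    - by rewrite disj_set2E; apply/eqP/seteqP; split => // x [? []].
    rewrite addeC (@integral_riesz_kernel_scale R n b l (eball 0 l))//; last first.
      exact: measurable_eball.
    have := preimage_dilate_ball n 1 l0; rewrite mulr1 => ->.
    by [].
  move: AE; rewrite -aE -EFinM => AE.
  rewrite mulrBr mulr1 EFinB {1}AE mulrC addeK//.
have expb (t : R) (c : R) : expR (- t) `^ c = expR (- (c * t)).
  by rewrite -expRM mulNr mulrC.
have expn (t : R) : expR (- t) ^+ n = expR (- (n%:R * t)).
  by rewrite -expRM_natl mulrN.
have onemexp_le (c t : R) : 1 - expR (- (c * t)) <= c * t.
  have := expR_ge1Dx (- (c * t)); lra.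
have onemexp_ge (c t : R) : c * t * expR (- (c * t)) <= 1 - expR (- (c * t)).
  have := expR_ge1Dx (c * t); rewrite -(ler_pM2r (expR_gt0 (- (c * t)))).
  by rewrite expRxMexpNx_1; lra.
have shell_exp (t : R) : 0 < t ->
    vn * (1 - expR (- (n%:R * t))) <= a * (1 - expR (- ((n%:R - b) * t))) <=
    expR (b * t) * (vn * (1 - expR (- (n%:R * t)))).
  move=> t0; have := shell (expR (- t)).
  rewrite expR_gt0 expR_lt1 oppr_lt0 t0 => /(_ isT).
  by rewrite !expb expn mulNr opprK.
suff : a * (n%:R - b) = vn * n%:R.
  by move=> av; rewrite [LHS](esym aE) mulrA -av mulfK// gt_eqF.
apply/eqP; rewrite eq_le; apply/andP; split.
  apply: (@ler_of_ler_expR _ n%:R) => //; first by rewrite mulr_ge0// ltW.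
  move=> t t0; have /andP[_ up] := shell_exp t t0.
  have e0 := expR_gt0 ((n%:R - b) * t).
  rewrite -(ler_pM2r t0) -(@ler_pM2r _ (expR (- ((n%:R - b) * t)))) ?expR_gt0//.
  have -> : vn * n%:R * expR (n%:R * t) * t * expR (- ((n%:R - b) * t)) =
      expR (b * t) * (vn * (n%:R * t)).
    have -> : expR (b * t) = expR (n%:R * t) * expR (- ((n%:R - b) * t)).
      by rewrite -expRD; congr expR; ring.
    ring.
  apply: (@le_trans _ _ (a * (1 - expR (- ((n%:R - b) * t))))).
    by rewrite -!mulrA ler_wpM2l// mulrA onemexp_ge.
  by apply: (le_trans up); rewrite ler_pM2l ?expR_gt0// ler_pM2l.
apply: (@ler_of_ler_expR _ n%:R) => //; first by rewrite mulr_ge0// ltW.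
move=> t t0; have /andP[lo _] := shell_exp t t0.
rewrite -(ler_pM2r t0) -(@ler_pM2r _ (expR (- (n%:R * t)))) ?expR_gt0//.
have -> : a * (n%:R - b) * expR (n%:R * t) * t * expR (- (n%:R * t)) =
    a * ((n%:R - b) * t).
  rewrite -[RHS]mulr1 -[X in _ = _ * X](expRxMexpNx_1 (n%:R * t)); ring.
apply: (@le_trans _ _ (vn * (1 - expR (- (n%:R * t))))).
  by rewrite -!mulrA ler_pM2l// mulrA onemexp_ge.
by apply: (le_trans lo); rewrite ler_wpM2l// onemexp_le.
Qed.

Lemma integral_riesz_kernel_ball (y : 'rV[R]_n) (rho : R) : 0 < rho ->
  (\int[mu]_(x in eball y rho) (k b (x - y))%:E =
   (rho `^ (n%:R - b) * (vn * (n%:R / (n%:R - b))))%:E)%E.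
Proof.
move=> r0.
have mB : measurable (eball (0 : 'rV[R]_n) rho) by exact: measurable_eball.
transitivity (\int[mu]_(x in eball 0 rho) (k b (x - 0))%:E)%E; last first.
  rewrite (integral_riesz_kernel_scale b r0)// EFinM.
  have := preimage_dilate_ball n 1 r0; rewrite mulr1 => ->.
  by rewrite integral_riesz_kernel_unit_ball.
have := @ge0_integral_affine R n (- y) 1 (eball 0 rho) (fun x => (k b (x - 0))%:E)
  (oner_neq0 _) mB (@measurable_riesz_kernelE R n b 0 _) (fun x => k_ge0 _).
rewrite normr1 expr1n invr1 mul1e => <-.
have -> : affine (- y) 1 @^-1` (eball 0 rho) = eball y rho.
  apply/seteqP; split => x;
  by rewrite /eball/= /affine scale1r subr0 addrC.
by apply: eq_integral => x _; rewrite /affine scale1r subr0 addrC.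
Qed.

(** Let B be the ball centered at y with |B| = |E|.  Then E \ B and B \ E have
the same measure, and the kernel is at most rho^-b on the first and at least
rho^-b on the second, so replacing E by B can only increase the integral. *)
Lemma integral_riesz_kernel_le (y : 'rV[R]_n) (E : set (Rn R n)) :
  measurable E -> (0 < mu E < +oo)%E ->
  (\int[mu]_(x in E) (k b (x - y))%:E <=
   (vn `^ (b / n%:R) * fine (mu E) `^ (1 - b / n%:R) * (n%:R / (n%:R - b)))%:E)%E.
Proof.
move=> mE /andP[E0 Eoo].
have : (fine (mu E))%:E = mu E by rewrite fineK// ge0_fin_numE// ltW.
set e := fine (mu E) => eE.
have e0 : 0 < e by rewrite -lte_fin eE.
have nR : n%:R != 0 :> R by rewrite pnatr_eq0 -lt0n.
pose rho := (e / vn) `^ n%:R^-1.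
have r0 : 0 < rho by rewrite powR_gt0 ?divr_gt0.
have rn : rho ^+ n = e / vn.
  by rewrite -powR_mulrn ?ltW// -powRrM mulVf// powRr1// ltW// divr_gt0.
pose B : set (Rn R n) := eball y rho.
have mB : measurable B by exact: measurable_eball.
have muB : mu B = mu E.
  by rewrite [LHS]lebesgue_eball// rn -eE mulrCA divff ?mulr1// gt_eqF.
have Boo : (mu B < +oo)%E by rewrite muB.
have mk D : measurable_fun D (fun x : Rn R n => (k b (x - y))%:E).
  exact: measurable_riesz_kernelE.
have rb0 : 0 <= rho `^ (- b) by exact: powR_ge0.
have mEB : measurable (E `\` B) by exact: measurableD.
have mBE : measurable (B `\` E) by exact: measurableD.
have mBI : measurable (B `&` E) by exact: measurableI.
have outside : (\int[mu]_(x in E `\` B) (k b (x - y))%:E <=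
    (rho `^ (- b))%:E * mu (E `\` B))%E.
  rewrite -integral_cst//; apply: le_integral_pointwise => x [_].
  rewrite /B/eball/= => /negP; rewrite -leNgt => rx.
  by rewrite lee_fin; apply: powRN_anti => //; exact: ltW.
have inside : ((rho `^ (- b))%:E * mu (B `\` E) <=
    \int[mu]_(x in B `\` E) (k b (x - y))%:E)%E.
  rewrite -integral_cst//; apply: ae_ge0_le_integral => //.
  apply: filterS (ae_neq y n_gt0) => x xy [Bx _].
  rewrite lee_fin; apply: powRN_anti; [exact: ltW| |exact: ltW].
  by rewrite enorm_gt0 subr_eq0; apply/eqP.
(* Both measures are |E| - |E `&` B|, as |B| = |E| is finite. *)
have muEB : mu (E `\` B) = mu (B `\` E).
  rewrite [LHS]measureD// [RHS]measureD// setIC.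
  by congr (_ - _)%E; exact: esym muB.
have -> : (vn `^ (b / n%:R) * e `^ (1 - b / n%:R) * (n%:R / (n%:R - b))) =
    rho `^ (n%:R - b) * (vn * (n%:R / (n%:R - b))).
  rewrite mulrA; congr (_ * _).
  have -> : vn `^ (b / n%:R) = vn `^ (-1 * (1 - b / n%:R)) * vn.
    rewrite -[X in _ = _ * X](powRr1 (ltW vn0)) -powRD ?(gt_eqF vn0) ?implybT//.
    by congr (_ `^ _); ring.
  rewrite /rho -(powRrM (e / vn)) powRM ?invr_ge0 ?(ltW e0) ?(ltW vn0)//.
  have -> : n%:R^-1 * (n%:R - b) = 1 - b / n%:R by field.
  rewrite -(powR_inv1 (ltW vn0)) -(powRrM vn); ring.
rewrite -(integral_riesz_kernel_ball y r0) -/B.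
rewrite -{1}(setDUK (@subIsetl _ E B)) setDIr setDv set0U.
rewrite -[X in (_ <= \int[mu]_(x in X) _)%E](setDUK (@subIsetl _ B E)) setDIr setDv set0U.
rewrite !ge0_integral_setU//; last 3 first.
- by rewrite disj_set2E; apply/eqP/seteqP; split => // x [[? ?] []].
- by rewrite setIC.
- by rewrite disj_set2E; apply/eqP/seteqP; split => // x [[? ?] []].
rewrite (setIC E B) leeD2l//.
by rewrite (le_trans outside)// muEB.
Qed.

End integral_riesz_kernel_ball.
(** * Upper bound for the weak norm *)

Section weighted_power_mean.
Local Open Scope ereal_scope.
Context d (T : measurableType d) (R : realType) (mu : {measure set T -> \bar R}).

(** For r > 1, Hoelder's inequality for w^(1/p) and w^(1/r) h, where
1/p + 1/r = 1. *)
Lemma weighted_power_mean_le (w h : T -> R) (r : R) :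
  measurable_fun setT w -> measurable_fun setT h ->
  (forall x, 0 <= w x)%R -> (forall x, 0 <= h x)%R -> (1 <= r)%R ->
  (\int[mu]_x (w x * h x)%:E) `^ r <=
  (\int[mu]_x (w x)%:E) `^ (r - 1) * \int[mu]_x (w x * (h x `^ r)%R)%:E.
Proof.
move=> mw mh w0 h0; rewrite le_eqVlt => /predU1P[<-|r1].
  rewrite subrr poweRe0 mul1e poweRe1; last first.
    by apply: integral_ge0 => x _; rewrite lee_fin mulr_ge0.
  by under [leRHS]eq_integral do rewrite powRr1//.
have r0 : (0 < r)%R by rewrite (lt_trans _ r1).
have r10 : (0 < r - 1)%R by rewrite subr_gt0.
pose p : R := (r / (r - 1))%R.
have p0 : (0 < p)%R by rewrite divr_gt0.
have pr : (p^-1 + r^-1 = 1)%R by rewrite /p; field; rewrite !gt_eqF.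
pose u x : R := (w x `^ p^-1)%R.
pose g x : R := (w x `^ r^-1 * h x)%R.
have mu_ : measurable_fun setT u.
  exact: (measurableT_comp (measurable_powR p^-1%R) mw).
have mg : measurable_fun setT g.
  apply: measurable_funM => //.
  exact: (measurableT_comp (measurable_powR r^-1%R) mw).
have ug x : (u x * g x = w x * h x)%R.
  rewrite /u /g mulrA -powRD ?pr ?powRr1//.
  by rewrite oner_eq0.
have := hoelder mu mu_ mg p0 r0 pr.
rewrite Lnorm1.
have -> : \int[mu]_x `|(u \* g)%R x|%:E = \int[mu]_x (w x * h x)%:E.
  by apply: eq_integral => x _; rewrite /= ug ger0_norm// mulr_ge0.
move=> /(@gt0_ler_poweR _ r (ltW r0)); rewrite !in_itv/= !leey !andbT.
have -> : 0 <= \int[mu]_x (w x * h x)%:E.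
  by apply: integral_ge0 => x _; rewrite lee_fin mulr_ge0.
rewrite mule_ge0 ?Lnorm_ge0// => /(_ isT isT) /le_trans; apply.
rewrite poweRM ?Lnorm_ge0// powR_Lnorm ?gt_eqF//.
rewrite -{1}(_ : (p * (r - 1))%R = r); last by rewrite /p; field; rewrite gt_eqF.
rewrite poweRrM powR_Lnorm ?gt_eqF//.
rewrite le_eqVlt; apply/orP; left; apply/eqP; congr (_ `^ _ * _).
- apply: eq_integral => x _ /=; rewrite ger0_norm ?powR_ge0// -powRrM.
  by rewrite mulVf ?powRr1// gt_eqF.
- apply: eq_integral => x _ /=.
  rewrite ger0_norm ?mulr_ge0 ?powR_ge0// powRM ?powR_ge0// -powRrM.
  by rewrite mulVf ?powRr1// gt_eqF.
Qed.

End weighted_power_mean.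
Section weak_type_upper_bound.
Context (R : realType) (n : nat).
Local Notation mu := (lebesgue R n).
Local Notation vn := (unit_ball_vol R n).
Local Notation k := (@riesz_kernel R n).
Implicit Types (f : 'rV[R]_n -> R) (g : 'rV[R]_n -> \bar R).

(** The function J f described above.  The argument of f is not translated,
so that the integrand is measurable in (x, y) for the product sigma-algebra
when f is only Lebesgue measurable; this is what exchanging integrals needs. *)
Definition riesz_majorant (a : R) f (x : 'rV[R]_n) : \bar R :=
  (\int[mu]_y (`|f y| * k a (x - y))%:E)%E.

Lemma measurable_riesz_kernelB (b : R) :
  measurable_fun setT (fun z : Rn R n * Rn R n => k b (z.1 - z.2)).
Proof.
apply: (measurableT_comp (f := @powR R ^~ (- b))); first exact: measurable_powR.
apply: measurable_enorm => i; under eq_fun do rewrite !mxE.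
apply: measurable_funB.
  exact: (measurableT_comp (@measurable_coord R n i) measurable_fst).
exact: (measurableT_comp (@measurable_coord R n i) measurable_snd).
Qed.

Lemma measurable_riesz_kernel_sub (b : R) (x : 'rV[R]_n) :
  measurable_fun setT (fun y : Rn R n => k b (x - y)).
Proof.
have /(_ b x) := @measurable_riesz_kernel R n.
by under eq_fun do rewrite -riesz_kernelN opprB.
Qed.

(** Convexity, exchange of the integrals and the estimate for the integral of
the kernel over a set of given measure. *)
Lemma weak_norm_le_of_majorant (s r c : R) f g :
  s < n%:R -> 1 <= r -> r < n%:R / (n%:R - s) -> 0 <= c ->
  mu.-integrable setT (EFin \o f : Rn R n -> \bar R) ->
  (forall x, `|g x| <= c%:E * riesz_majorant (n%:R - s) f x)%E ->
  (weak_norm s r g <=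
    (c * vn `^ ((n%:R - s) / n%:R) *
     (n%:R / (n%:R - (n%:R - s) * r)) `^ r^-1)%:E *
    \int[mu]_x `|f x|%:E)%E.
Proof.
set a := n%:R - s => sn r1 ra c0 intf gJ.
have a0 : 0 < a by rewrite subr_gt0.
have r0 : 0 < r by exact: lt_le_trans r1.
have b0 : 0 < a * r by exact: mulr_gt0.
have bn : a * r < n%:R by rewrite mulrC -ltr_pdivlMr.
have nR : 0 < n%:R :> R by exact: lt_trans bn.
have vn0 : 0 < vn := unit_ball_vol_gt0 R n.
have mf : measurable_fun setT (f : Rn R n -> R).
  by apply/measurable_EFinP; exact: (measurable_int mu).
have mnf : measurable_fun setT (fun y : Rn R n => `|f y|).
  exact: measurableT_comp mf.
have Foo : (\int[mu]_x `|f x|%:E < +oo)%E by have /integrableP[] := intf.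
set F := (\int[mu]_x `|f x|%:E)%E in Foo *.
have F0 : (0 <= F)%E by apply: integral_ge0 => x _; rewrite lee_fin.
have : (fine F)%:E = F by rewrite fineK// ge0_fin_numE.
set phi := fine F => phiE.
have phi0 : 0 <= phi by exact: fine_ge0.
apply: ge_ereal_sup => _ [E [mE Eoo] <-]; rewrite -/a.
have : (fine (mu E))%:E = mu E.
  by move/andP: Eoo => [E0 Eoo]; rewrite fineK// ge0_fin_numE// ltW.
set e := fine (mu E) => eE.
have e0 : 0 < e by rewrite -lte_fin eE; case/andP: Eoo.
pose N := n%:R / (n%:R - a * r).
have N0 : 0 < N by rewrite divr_gt0// subr_gt0.
pose K := vn `^ (a * r / n%:R) * e `^ (1 - a * r / n%:R) * N.
have K0 : 0 <= K by rewrite mulr_ge0 ?(ltW N0)// mulr_ge0 ?powR_ge0.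
have main : (\int[mu]_(x in E) `|g x| `^ r <=
    ((c * phi) `^ r * K)%:E)%E.
  pose G (z : Rn R n * Rn R n) : \bar R :=
    ((\1_E z.1 : R) * (`|f z.2| * k (a * r) (z.1 - z.2)))%:E.
  have mG : measurable_fun setT G.
    apply/measurable_EFinP; apply: measurable_funM.
      by apply: (measurableT_comp _ measurable_fst); exact: measurable_indic.
    apply: measurable_funM; last exact: measurable_riesz_kernelB.
    exact: (measurableT_comp mnf measurable_snd).
  have G0 z : (0 <= G z)%E.
    by rewrite lee_fin !mulr_ge0// riesz_kernel_ge0.
  pose H x : \bar R := (\int[mu]_y G (x, y))%E.
  have H0 x : (0 <= H x)%E by apply: integral_ge0 => y _; exact: G0.
  have mH : measurable_fun (setT : set (Rn R n)) H.
    exact: (@measurable_fun_fubini_tonelli_F _ _ (Rn R n) (Rn R n) R mu G mG G0).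
  have q0 : 0 <= c `^ r * phi `^ (r - 1) by rewrite mulr_ge0 ?powR_ge0.
  apply: (@le_trans _ _
    (\int[mu]_x ((c `^ r * phi `^ (r - 1))%:E * H x))%E).
    rewrite integral_mkcond; apply: le_integral_pointwise => x _.
    rewrite /patch; case: ifPn => [xE|_]; last first.
      by rewrite mule_ge0 ?lee_fin.
    have J0 : (0 <= riesz_majorant a f x)%E.
      by apply: integral_ge0 => y _; rewrite lee_fin mulr_ge0 ?riesz_kernel_ge0.
    apply: (@le_trans _ _ ((c%:E * riesz_majorant a f x) `^ r)%E).
      apply: gt0_ler_poweR; [exact: ltW| | |exact: gJ];
        by rewrite in_itv/= ?abse_ge0 ?leey// mule_ge0 ?lee_fin.
    rewrite poweRM ?lee_fin// poweR_EFin EFinM -muleA.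
    apply: lee_wpmul2l; first by rewrite lee_fin powR_ge0.
    have mk := measurable_riesz_kernel_sub a x.
    apply: le_trans (weighted_power_mean_le mu mnf mk _ _ r1) _ => //.
      by move=> y; exact: riesz_kernel_ge0.
    rewrite -/F -phiE poweR_EFin; apply: lee_wpmul2l; first by rewrite lee_fin powR_ge0.
    apply: le_integral_pointwise => y _; rewrite /G/= lee_fin indicE xE mul1r.
    by rewrite riesz_kernelX.
  rewrite (@ge0_integralZl _ _ _ mu _ measurableT H mH)//.
  rewrite /H (@fubini_tonelli _ _ _ _ _ mu mu G)//.
  apply: (@le_trans _ _ ((c `^ r * phi `^ (r - 1))%:E * \int[mu]_y (K%:E * `|f y|%:E))%E).
    apply: lee_wpmul2l; first by rewrite lee_fin.
    apply: le_integral_pointwise => y _.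
    have := integral_riesz_kernel_le b0 bn y mE Eoo.
    rewrite -/e -/N -/K => kK.
    rewrite muleC.
    apply: (@le_trans _ _ (`|f y|%:E * \int[mu]_(x in E) (k (a * r) (x - y))%:E)%E); last first.
      by apply: lee_wpmul2l => //; rewrite lee_fin.
    have mkE := @measurable_riesz_kernelE R n (a * r) y E.
    rewrite -(@ge0_integralZl _ _ _ mu E mE _ mkE)//; last first.
      by move=> x _; rewrite lee_fin riesz_kernel_ge0.
    rewrite [leRHS]integral_mkcond.
    apply: le_integral_pointwise => x _; rewrite /G/patch/= indicE.
    by case: ifP => _; rewrite ?mul1r ?mul0r ?mule0.
  have mnfE : measurable_fun setT (fun y : Rn R n => `|f y|%:E).
    exact/measurable_EFinP.
  rewrite (@ge0_integralZl _ _ _ mu _ measurableT _ mnfE)//.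
  rewrite -/F -phiE -!EFinM lee_fin powRM//.
  rewrite -(@mulr_powRB1 _ phi r)//; lra.
set I := (\int[mu]_(x in E) `|g x| `^ r)%E in main *.
have I0 : (0 <= I)%E by apply: integral_ge0 => x _; exact: poweR_ge0.
apply: (@le_trans _ _ (mu E `^ (- r^-1 + a / n%:R) * ((c * phi) `^ r * K)%:E `^ r^-1)%E).
  apply: lee_wpmul2l; first exact: poweR_ge0.
  apply: gt0_ler_poweR => //; first by rewrite invr_ge0 ltW.
    by rewrite in_itv/= I0 leey.
  by rewrite in_itv/= leey andbT lee_fin mulr_ge0// powR_ge0.
rewrite -eE -phiE !poweR_EFin -!EFinM lee_fin.
rewrite -/N /K; clear main K0 K I I0; clearbody N.
have Nr : 0 <= N `^ r^-1 by exact: powR_ge0.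
rewrite (@powRM _ ((c * phi) `^ r)) ?powR_ge0//; last first.
  by rewrite mulr_ge0 ?(ltW N0)// mulr_ge0 ?powR_ge0.
rewrite (@powRM _ (_ * _) N) ?(ltW N0) ?mulr_ge0 ?powR_ge0//.
rewrite (@powRM _ (vn `^ _)) ?powR_ge0//.
rewrite -(powRrM (c * phi)) -(powRrM vn) -(powRrM e).
rewrite mulfV ?gt_eqF// powRr1 ?mulr_ge0//.
have -> : a * r / n%:R / r = a / n%:R by field; rewrite !gt_eqF.
have -> : (1 - a * r / n%:R) / r = - (- r^-1 + a / n%:R) by field; rewrite !gt_eqF.
rewrite powRN.
have eN : e `^ (- r^-1 + a / n%:R) != 0 by rewrite gt_eqF// powR_gt0.
rewrite le_eqVlt; apply/orP; left; apply/eqP; field.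
exact: eN.
Qed.

End weak_type_upper_bound.
(** * Lower bound for the weak norm *)

Section weak_norm_lower_bound.
Context (R : realType) (n : nat) (s r : R).
Hypotheses (sn : s < n%:R) (r1 : 1 <= r) (ra : r < n%:R / (n%:R - s)).
Local Notation mu := (lebesgue R n).
Local Notation vn := (unit_ball_vol R n).
Local Notation k := (@riesz_kernel R n).
Local Notation a := (n%:R - s).
Implicit Types (f : 'rV[R]_n -> R) (g : 'rV[R]_n -> \bar R).

Let a0 : 0 < a. Proof. by rewrite subr_gt0. Qed.
Let r0 : 0 < r. Proof. exact: lt_le_trans r1. Qed.
Let b0 : 0 < a * r. Proof. exact: mulr_gt0. Qed.
Let bn : a * r < n%:R. Proof. by rewrite mulrC -ltr_pdivlMr. Qed.
Let nR : 0 < n%:R :> R. Proof. exact: lt_trans bn. Qed.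
Let n_gt0 : (0 < n)%N. Proof. by rewrite -(@ltr_nat R). Qed.
Let vn0 : 0 < vn := unit_ball_vol_gt0 R n.
Let N := n%:R / (n%:R - a * r).
Let N0 : 0 < N. Proof. by rewrite divr_gt0// subr_gt0. Qed.

Lemma integral_riesz_kernel_shell_ball (rho d : R) : 0 < rho -> 0 < d < 1 ->
  (\int[mu]_(x in eball 0 rho `\` eball 0 (d * rho)) (k (a * r) (x - 0))%:E =
   (rho `^ (n%:R - a * r) * (1 - d `^ (n%:R - a * r)) * (vn * N))%:E)%E.
Proof.
move=> rho0 /andP[d0 d1].
have sub : eball (0 : 'rV[R]_n) (d * rho) `<=` eball 0 rho.
  move=> x; rewrite /eball/= => /lt_le_trans; apply.
  by rewrite ler_piMl ?ltW.
have := integral_riesz_kernel_ball b0 bn (0 : 'rV[R]_n) rho0.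
rewrite -{1}(setDUK sub) ge0_integral_setU//; last 5 first.
- exact: measurable_eball.
- exact: measurable_shell.
- exact: measurable_riesz_kernelE.
- by move=> x _; rewrite lee_fin riesz_kernel_ge0.
- by rewrite disj_set2E; apply/eqP/seteqP; split => // x [? []].
rewrite (integral_riesz_kernel_ball b0 bn _ (mulr_gt0 d0 rho0)).
rewrite powRM ?(ltW d0) ?(ltW rho0)// -/N.
move=> /(congr1 (fun z =>
  z - (d `^ (n%:R - a * r) * rho `^ (n%:R - a * r) * (vn * N))%:E)%E).
rewrite addeAC subee// add0e => SE; rewrite [LHS]SE.
by rewrite -EFinB; congr EFin; ring.
Qed.

(** Test the weak norm on the ball of radius rho = L / d^2, keeping only the
part d rho <= |x|.  There L = d (d rho) <= d |x|, so |x| + L <= (1 + d) |x|,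
and g is at least m (1 + d)^-a |x|^-a. *)
Lemma weak_norm_ge_shell (m L d : R) g : 0 <= m -> 0 < L -> 0 < d < 1 ->
  (forall x, (m * (enorm x + L) `^ (- a))%:E <= `|g x|)%E ->
  ((m * vn `^ (a / n%:R) * N `^ r^-1 *
     ((1 + d) `^ (- a) * (1 - d `^ (n%:R - a * r)) `^ r^-1))%:E <=
   weak_norm s r g)%E.
Proof.
move=> m0 L0 d01 mg; have /andP[d0 d1] := d01.
pose rho := L / d ^+ 2.
have rho0 : 0 < rho by rewrite divr_gt0// exprn_gt0.
pose E : set (Rn R n) := eball 0 rho.
have mE : measurable E by exact: measurable_eball.
have muE : mu E = (vn * rho ^+ n)%:E by exact: lebesgue_eball.
have e0 : 0 < vn * rho ^+ n by rewrite mulr_gt0// exprn_gt0.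
pose S : set (Rn R n) := E `\` eball 0 (d * rho).
have mS : measurable S by exact: measurable_shell.
pose q := 1 - d `^ (n%:R - a * r).
have q0 : 0 <= q.
  have : d `^ (n%:R - a * r) <= 1 `^ (n%:R - a * r).
    apply: ge0_ler_powR; rewrite ?nnegrE ?ler01 ?(ltW d0) ?(ltW d1)//.
    by rewrite subr_ge0 ltW.
  by rewrite powR1 subr_ge0.
have c0 : 0 <= m * (1 + d) `^ (- a) by rewrite mulr_ge0// powR_ge0.
have lower : (((m * (1 + d) `^ (- a)) `^ r *
    (rho `^ (n%:R - a * r) * q * (vn * N)))%:E <=
    \int[mu]_(x in E) `|g x| `^ r)%E.
  rewrite EFinM -integral_riesz_kernel_shell_ball// -/E -/S.
  have mkS := @measurable_riesz_kernelE R n (a * r) 0 S.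
  rewrite -(@ge0_integralZl _ _ _ mu S mS _ mkS); last 2 first.
  - by move=> x _; rewrite lee_fin riesz_kernel_ge0.
  - by rewrite lee_fin powR_ge0.
  rewrite integral_mkcond [leRHS]integral_mkcond.
  apply: le_integral_pointwise => x _; rewrite /patch.
  case: ifPn => [|_]; last by case: ifP => // _; exact: poweR_ge0.
  rewrite inE => -[Ex]; rewrite (mem_set Ex) /eball/= !subr0 => /negP; rewrite -leNgt => dx.
  rewrite -riesz_kernelX -EFinM -powRM ?riesz_kernel_ge0// -poweR_EFin.
  apply: gt0_ler_poweR; first exact: ltW.
  - by rewrite in_itv/= leey andbT lee_fin mulr_ge0// riesz_kernel_ge0.
  - by rewrite in_itv/= leey andbT abse_ge0.
  apply: le_trans (mg x); rewrite lee_fin -mulrA ler_wpM2l// /riesz_kernel.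
  have x0 : 0 < enorm x by rewrite (lt_le_trans _ dx)// mulr_gt0.
  rewrite -powRM ?enorm_ge0//; last by rewrite addr_ge0// ltW.
  apply: powRN_anti; [exact: ltW|by rewrite addr_gt0|].
  rewrite mulrDl mul1r lerD2l.
  have -> : L = d * (d * rho) by rewrite /rho; field; rewrite gt_eqF.
  by rewrite ler_pM2l.
have W : (mu E `^ (- r^-1 + a / n%:R) *
    (\int[mu]_(x in E) `|g x| `^ r) `^ r^-1 <= weak_norm s r g)%E.
  apply: ereal_sup_ubound; exists E => //; split => //.
  by rewrite muE lte_fin e0 ltry.
apply: le_trans W.
have c1 : 0 <= (m * (1 + d) `^ (- a)) `^ r *
    (rho `^ (n%:R - a * r) * q * (vn * N)).
  have vN0 : 0 <= vn * N := mulr_ge0 (ltW vn0) (ltW N0).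
  by rewrite mulr_ge0 ?powR_ge0// (mulr_ge0 _ vN0)// mulr_ge0 ?powR_ge0.
apply: (@le_trans _ _ ((vn * rho ^+ n)%:E `^ (- r^-1 + a / n%:R) *
    ((m * (1 + d) `^ (- a)) `^ r *
    (rho `^ (n%:R - a * r) * q * (vn * N)))%:E `^ r^-1)%E); last first.
  rewrite -muE; apply: lee_wpmul2l; first exact: poweR_ge0.
  apply: gt0_ler_poweR => //; first by rewrite invr_ge0 ltW.
    by rewrite in_itv/= leey andbT lee_fin.
  rewrite in_itv/= leey andbT; apply: integral_ge0 => x _; exact: poweR_ge0.
rewrite !poweR_EFin -EFinM lee_fin -/q.
clear lower c1 muE mE mS; move: N N0 => M M0.
have rr : (rho `^ (n%:R - a * r)) `^ r^-1 = rho `^ (n%:R / r - a).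
  by rewrite -powRrM; congr (_ `^ _); field; rewrite gt_eqF.
have er : (vn * rho ^+ n) `^ (- r^-1 + a / n%:R) =
    vn `^ (a / n%:R) / vn `^ r^-1 * (rho `^ (n%:R / r - a))^-1.
  rewrite powRM ?(ltW vn0) ?exprn_ge0 ?(ltW rho0)//; congr (_ * _).
    by rewrite addrC powRB// (gt_eqF vn0) implybT.
  rewrite -powR_mulrn ?(ltW rho0)// -powRrM -powRN; congr (_ `^ _).
  by field; rewrite !gt_eqF.
have rho_ne : rho `^ (n%:R / r - a) != 0 by rewrite gt_eqF// powR_gt0.
have v_ne : vn `^ r^-1 != 0 by rewrite gt_eqF// powR_gt0.
rewrite (@powRM _ ((m * (1 + d) `^ (- a)) `^ r)) ?powR_ge0//; last first.
  by rewrite !mulr_ge0 ?powR_ge0 ?(ltW vn0) ?(ltW M0).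
rewrite -(powRrM (m * _)) mulfV ?gt_eqF// powRr1//.
rewrite (@powRM _ (rho `^ (n%:R - a * r) * q)) ?mulr_ge0 ?powR_ge0 ?(ltW vn0) ?(ltW M0)//.
rewrite (@powRM _ (rho `^ (n%:R - a * r)) q) ?powR_ge0//.
rewrite (@powRM _ vn M) ?(ltW vn0) ?(ltW M0)// rr er.
rewrite le_eqVlt; apply/orP; left; apply/eqP; field.
by rewrite rho_ne v_ne.
Qed.

End weak_norm_lower_bound.
Section weak_norm_minorant.
Context (R : realType) (n : nat) (s r : R).
Hypotheses (sn : s < n%:R) (r1 : 1 <= r) (ra : r < n%:R / (n%:R - s)).
Local Notation mu := (lebesgue R n).
Local Notation vn := (unit_ball_vol R n).
Local Notation a := (n%:R - s).
Implicit Types (f : 'rV[R]_n -> R) (g : 'rV[R]_n -> \bar R).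

Let a0 : 0 < a. Proof. by rewrite subr_gt0. Qed.
Let r0 : 0 < r. Proof. exact: lt_le_trans r1. Qed.
Let gap : 0 < n%:R - a * r. Proof. by rewrite subr_gt0 mulrC -ltr_pdivlMr. Qed.

(** The factor is at least (1 - a d) (1 - d^(n - a r)), which tends to 1 as
d -> 0+. *)
Lemma exists_decay_factor_gt (t : R) : t < 1 ->
  exists2 d, 0 < d < 1 & t < (1 + d) `^ (- a) * (1 - d `^ (n%:R - a * r)) `^ r^-1.
Proof.
move=> t1.
have cvh : (1 - a * d) * (1 - d `^ (n%:R - a * r)) @[d --> (0 : R)^'+] --> (1 : R).
  rewrite -[X in _ --> X](_ : (1 - a * 0) * (1 - 0) = 1); last by rewrite mulr0 subr0 mul1r.
  apply: cvgM; apply: cvgB; [exact: cvg_cst| |exact: cvg_cst|exact: powR_cvg0].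
  apply: cvgM; first exact: cvg_cst.
  exact: cvg_at_right_filter cvg_id.
have [d [[d0 d1 da] td]] : exists d, [/\ 0 < d, d < 1 & d < a^-1] /\
    t < (1 - a * d) * (1 - d `^ (n%:R - a * r)).
  apply: (@filter_ex _ (0 : R)^'+); near=> d; split; last first.
    by near: d; apply: cvgr_gt cvh _ t1.
  split; near: d; [exact: nbhs_right_gt|exact: nbhs_right_lt|].
  by apply: nbhs_right_lt; rewrite invr_gt0.
exists d; first by rewrite d0 d1.
apply: (lt_le_trans td).
have q1 : d `^ (n%:R - a * r) < 1.
  have : d `^ (n%:R - a * r) < 1 `^ (n%:R - a * r).
    by apply: gt0_ltr_powR; rewrite ?nnegrE ?ler01 ?(ltW d0).
  by rewrite powR1.
have q0 := powR_ge0 d (n%:R - a * r).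
apply: ler_pM.
- by rewrite subr_ge0 -ler_pdivlMl// mulr1 ltW.
- by rewrite subr_ge0 ltW.
- rewrite /powR gt_eqF; last by rewrite addr_gt0.
  apply: le_trans (expR_ge1Dx _); rewrite lerD2l mulNr lerN2 ler_pM2l//.
  by apply: le_ln1Dx; rewrite (lt_trans _ d0)// ltrN10.
- apply: ger1_powR; first by rewrite subr_gt0 q1/= gerBl.
  by rewrite invf_le1.
Unshelve. all: by end_near. Qed.

(** The bound of weak_norm_ge_shell holds for every d in (0, 1); its last factor
is made as close to 1 as needed to contradict a smaller weak norm. *)
Lemma weak_norm_ge_decay (m L : R) g : 0 <= m -> 0 < L ->
  (forall x, (m * (enorm x + L) `^ (- a))%:E <= `|g x|)%E ->
  ((m * vn `^ (a / n%:R) * (n%:R / (n%:R - a * r)) `^ r^-1)%:E <= weak_norm s r g)%E.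
Proof.
move=> m0 L0 mg; set C := _ * _ * _.
have C0 : 0 <= C by rewrite !mulr_ge0// powR_ge0.
have W (d : R) : 0 < d < 1 ->
    ((C * ((1 + d) `^ (- a) * (1 - d `^ (n%:R - a * r)) `^ r^-1))%:E <=
    weak_norm s r g)%E.
  by move=> d01; exact: weak_norm_ge_shell mg.
rewrite leNgt; apply/negP => WC.
have W0 : (0 <= weak_norm s r g)%E.
  have [d d01 d0] := exists_decay_factor_gt ltr01.
  by apply: le_trans (W d d01); rewrite lee_fin mulr_ge0// ltW.
have : (fine (weak_norm s r g))%:E = weak_norm s r g.
  by rewrite fineK// ge0_fin_numE// (lt_trans WC)// ltry.
set w := fine _ => wE; rewrite -wE lte_fin in WC.
have w0 : 0 <= w by rewrite fine_ge0.
have Cp : 0 < C by exact: le_lt_trans WC.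
have wC1 : w / C < 1 by rewrite ltr_pdivrMr// mul1r.
have [d d01 dw] := exists_decay_factor_gt wC1.
have := W d d01; rewrite -wE lee_fin; apply/negP; rewrite -ltNge.
by rewrite -ltr_pdivrMl// mulrC.
Qed.

(** Let L -> oo in weak_norm_ge_decay, taking for m the product of c and the
integral of |f| over the ball of radius L. *)
Lemma weak_norm_ge_of_minorant (c : R) f g : 0 <= c ->
  mu.-integrable setT (EFin \o f : Rn R n -> \bar R) ->
  (forall (x : 'rV[R]_n) (L : R), 0 < L ->
    ((c * (enorm x + L) `^ (- a))%:E * \int[mu]_(y in eball 0 L) `|f y|%:E <= `|g x|)%E) ->
  ((c * vn `^ (a / n%:R) * (n%:R / (n%:R - a * r)) `^ r^-1)%:E *
    \int[mu]_x `|f x|%:E <= weak_norm s r g)%E.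
Proof.
move=> c0 intf cg; set C := _ * _ * _.
have mf : measurable_fun setT (f : Rn R n -> R).
  by apply/measurable_EFinP; exact: (measurable_int mu).
have mnf (D : set (Rn R n)) : measurable_fun D (fun y : Rn R n => `|f y|%:E).
  by apply/measurable_funTS/measurable_EFinP; exact: measurableT_comp mf.
have Foo : (\int[mu]_x `|f x|%:E < +oo)%E by have /integrableP[] := intf.
pose B j : set (Rn R n) := eball 0 j.+1%:R.
have mB j : measurable (B j) by exact: measurable_eball.
have ndB : nondecreasing_seq B.
  apply/nondecreasing_seqP => j; apply/subsetPset => x; rewrite /B /eball/=.
  by move/lt_le_trans; apply; rewrite ler_nat.
have UB : \bigcup_j B j = setT.
  apply/seteqP; split => // x _; exists (Num.truncn (enorm x)) => //=.
  by rewrite /B /eball/= subr0; exact: truncnS_gt.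
have cvF := @ge0_nondecreasing_set_cvg_integral _ _ _ B _ mu ndB mB
  (fun j => mnf (B j)) (fun _ x _ => normr_ge0 (f x)).
rewrite UB in cvF.
have cvCF : (C%:E * \int[mu]_(x in B j) `|f x|%:E @[j --> \oo] -->
    C%:E * \int[mu]_x `|f x|%:E)%E by exact: cvgeZl.
rewrite -(cvg_lim _ cvCF)//; apply: lime_le.
  by apply/cvg_ex; eexists; exact: cvCF.
apply: nearW => j.
have : (fine (\int[mu]_(y in B j) `|f y|%:E))%:E = (\int[mu]_(y in B j) `|f y|%:E)%E.
  rewrite fineK// ge0_fin_numE; last by apply: integral_ge0 => x _; rewrite lee_fin.
  by apply: le_lt_trans Foo; apply: ge0_subset_integral.
set phi := fine _ => phiE.
have phi0 : 0 <= phi by rewrite fine_ge0// integral_ge0.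
have := @weak_norm_ge_decay (c * phi) j.+1%:R g (mulr_ge0 c0 phi0) (ltr0Sn _ _).
rewrite -phiE -EFinM => H.
have -> : C * phi = c * phi * vn `^ (a / n%:R) * (n%:R / (n%:R - a * r)) `^ r^-1.
  by rewrite /C; ring.
apply: H => x; have := cg x _ (ltr0Sn _ j).
by rewrite -/(B j) -phiE -EFinM mulrAC.
Qed.

End weak_norm_minorant.
(** * The Riesz potential and the fractional maximal function *)

Section operators.
Context (R : realType) (n : nat) (s : R).
Hypotheses (s0 : 0 < s) (sn : s < n%:R).
Local Notation mu := (lebesgue R n).
Local Notation vn := (unit_ball_vol R n).
Local Notation k := (@riesz_kernel R n).
Local Notation a := (n%:R - s).
Implicit Types (f : 'rV[R]_n -> R) (x : 'rV[R]_n).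

Let a0 : 0 < a. Proof. by rewrite subr_gt0. Qed.
Let nR : 0 < n%:R :> R. Proof. exact: lt_trans sn. Qed.
Let n_gt0 : (0 < n)%N. Proof. by rewrite -(@ltr_nat R). Qed.
Let vn0 : 0 < vn := unit_ball_vol_gt0 R n.

Lemma ae_affine (z : 'rV[R]_n) (l : R) (P : 'rV[R]_n -> Prop) : l != 0 ->
  {ae mu, forall y : Rn R n, P y} -> {ae mu, forall y : Rn R n, P (affine z l y)}.
Proof.
move=> l0 [A [mA A0 PA]]; exists (affine z l @^-1` A); split.
- rewrite -[X in measurable X]setTI.
  exact: (measurable_affine z l0 measurableT mA).
- have := @lebesgue_outer_preimage_affine R n z l A l0.
  by rewrite [X in (_ * X)%E]A0 mule0.
- by move=> y /= Py; apply: PA.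
Qed.

Lemma Gamma_ge0 (t : R) : 0 <= Gamma t.
Proof. by apply: Rintegral_ge0 => u _; rewrite mulr_ge0 ?powR_ge0 ?expR_ge0. Qed.

Lemma riesz_const_ge0 : 0 <= riesz_const n s.
Proof. by rewrite !mulr_ge0 ?powR_ge0 ?invr_ge0 ?Gamma_ge0. Qed.

Lemma riesz_majorantE f x : measurable_fun setT (f : Rn R n -> R) ->
  (\int[mu]_y (`|f (x - y)| * k a y)%:E = riesz_majorant a f x)%E.
Proof.
move=> mf; pose h (z : Rn R n) := (`|f z| * k a (x - z))%:E.
have mh : measurable_fun setT h.
  apply/measurable_EFinP/measurable_funM; first exact: measurableT_comp mf.
  exact: measurable_riesz_kernel_sub.
have h0 z : (0 <= h z)%E by rewrite lee_fin mulr_ge0// riesz_kernel_ge0.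
have N1 : (-1 : R) != 0 by rewrite oppr_eq0 oner_eq0.
have := ge0_integral_affine x N1 measurableT mh h0.
rewrite preimage_setT normrN1 expr1n invr1 mul1e => /(eq_trans _); apply.
apply: eq_integral => y _; rewrite /h /affine scaleN1r.
by rewrite opprB addrCA subrr addr0.
Qed.

Lemma measurable_riesz_integrand f x : measurable_fun setT (f : Rn R n -> R) ->
  measurable_fun setT (fun y : Rn R n => (f (x - y) / enorm y `^ a)%:E).
Proof.
move=> mf; apply/measurable_EFinP; apply: measurable_funM.
  have N1 : (-1 : R) != 0 by rewrite oppr_eq0 oner_eq0.
  have := measurableT_comp mf (measurable_affine x N1).
  by congr measurable_fun; apply/funext => y /=; rewrite /affine scaleN1r.
have := @measurable_riesz_kernel R n a 0.
by congr measurable_fun; apply/funext => y /=; rewrite subr0 /riesz_kernel powRN.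
Qed.

Lemma riesz_potential_le_majorant f x : measurable_fun setT (f : Rn R n -> R) ->
  (`|riesz_potential s f x| <= (riesz_const n s)%:E * riesz_majorant a f x)%E.
Proof.
move=> mf; rewrite /riesz_potential abseM gee0_abs ?lee_fin ?riesz_const_ge0//.
apply: lee_wpmul2l; first by rewrite lee_fin riesz_const_ge0.
apply: le_trans (le_abse_integral _ measurableT (measurable_riesz_integrand x mf)) _.
rewrite -riesz_majorantE//; apply: le_integral_pointwise => y _.
rewrite abse_EFin lee_fin normrM /riesz_kernel powRN normfV.
by rewrite (ger0_norm (powR_ge0 _ _)); exact: lexx.
Qed.

(** Almost everywhere positivity of f passes to y |-> f (x - y), for every x. *)
Lemma riesz_potential_pos_eq f x : measurable_fun setT (f : Rn R n -> R) ->
  {ae mu, forall y, 0 < f y} ->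
  riesz_potential s f x = ((riesz_const n s)%:E * riesz_majorant a f x)%E.
Proof.
move=> mf fpos; rewrite /riesz_potential -riesz_majorantE//; congr (_ * _)%E.
apply: ae_eq_integral => //.
- exact: measurable_riesz_integrand.
- have := measurable_riesz_integrand x (measurableT_comp (@normr_measurable R setT) mf).
  by congr measurable_fun; apply/funext => y /=; rewrite /riesz_kernel powRN.
have N1 : (-1 : R) != 0 by rewrite oppr_eq0 oner_eq0.
apply: filterS (ae_affine x N1 fpos) => y; rewrite /affine scaleN1r => fy _.
by rewrite /riesz_kernel powRN ger0_norm// ltW.
Qed.

(** The point y = x, where the kernel has been given the value 0, is negligible
and is left out of the hypothesis. *)
Lemma riesz_majorant_ge_on f x (c : R) (D : set (Rn R n)) :
  measurable_fun setT (f : Rn R n -> R) -> measurable D -> 0 <= c ->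
  (forall y, D y -> y <> x -> c <= k a (x - y)) ->
  (c%:E * \int[mu]_(y in D) `|f y|%:E <= riesz_majorant a f x)%E.
Proof.
move=> mf mD c0 ck.
have mnf : measurable_fun D (fun y : Rn R n => `|f y|%:E).
  by apply/measurable_funTS/measurable_EFinP; exact: measurableT_comp mf.
have mh A : measurable_fun A (fun y : Rn R n => (`|f y| * k a (x - y))%:E).
  apply/measurable_funTS/measurable_EFinP/measurable_funM.
    exact: measurableT_comp mf.
  exact: measurable_riesz_kernel_sub.
have h0 (y : 'rV[R]_n) : (0 <= (`|f y| * k a (x - y))%:E)%E.
  by rewrite lee_fin mulr_ge0// riesz_kernel_ge0.
rewrite -(@ge0_integralZl _ _ _ mu _ mD _ mnf)//.
apply: (@le_trans _ _ (\int[mu]_(y in D) (`|f y| * k a (x - y))%:E)%E); last first.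
  exact: ge0_subset_integral.
apply: ae_ge0_le_integral => //.
- by move=> y _; rewrite -EFinM lee_fin mulr_ge0.
- exact: measurable_funeM.
apply: filterS (ae_neq x n_gt0) => y yx Dy.
by rewrite -EFinM lee_fin mulrC ler_wpM2l// ck.
Qed.

Lemma riesz_majorant_ge_ball f x (L : R) :
  measurable_fun setT (f : Rn R n -> R) -> 0 < L ->
  (((enorm x + L) `^ (- a))%:E * \int[mu]_(y in eball 0 L) `|f y|%:E <=
   riesz_majorant a f x)%E.
Proof.
move=> mf L0; apply: riesz_majorant_ge_on; rewrite ?powR_ge0//.
  exact: measurable_eball.
move=> y; rewrite /eball/= subr0 => yL yx; apply: powRN_anti; first exact: ltW.
  by rewrite enorm_gt0 subr_eq0 eq_sym; apply/eqP.
by rewrite (le_trans (ler_enormD _ _))// lerD2l enormN; exact: ltW.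
Qed.

Lemma frac_maximal_coef x (rho : R) : 0 < rho ->
  ((mu (eball x rho) `^ (1 - s / n%:R))^-1 =
   ((vn `^ (a / n%:R))^-1 * rho `^ (- a))%:E)%E.
Proof.
move=> rho0; rewrite [X in (X `^ _)%E]lebesgue_eball// poweR_EFin.
have -> : 1 - s / n%:R = a / n%:R by field; rewrite gt_eqF.
have e0 : 0 < vn * rho ^+ n by rewrite mulr_gt0// exprn_gt0.
rewrite inver gt_eqF ?powR_gt0//; congr EFin.
rewrite powRM ?(ltW vn0) ?exprn_ge0 ?(ltW rho0)// invfM; congr (_ * _).
rewrite -powR_mulrn ?(ltW rho0)// -powRrM -powRN; congr (_ `^ _).
by field; rewrite gt_eqF.
Qed.

Lemma frac_maximal_ge f x (rho : R) : 0 < rho ->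
  (((vn `^ (a / n%:R))^-1 * rho `^ (- a))%:E *
     \int[mu]_(y in eball x rho) `|f y|%:E <= frac_maximal s f x)%E.
Proof.
move=> rho0; rewrite -(frac_maximal_coef x rho0).
by apply: ereal_sup_ubound; exists rho.
Qed.

Lemma frac_maximal_ge0 f x : (0 <= frac_maximal s f x)%E.
Proof.
apply: le_trans (frac_maximal_ge f x ltr01).
apply: mule_ge0; first by rewrite lee_fin mulr_ge0 ?invr_ge0 ?powR_ge0.
by apply: integral_ge0 => y _; rewrite lee_fin.
Qed.

Lemma frac_maximal_le_majorant f x : measurable_fun setT (f : Rn R n -> R) ->
  (`|frac_maximal s f x| <= ((vn `^ (a / n%:R))^-1)%:E * riesz_majorant a f x)%E.
Proof.
move=> mf; rewrite gee0_abs ?frac_maximal_ge0//.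
apply: ge_ereal_sup => _ [rho /= rho0 <-].
rewrite frac_maximal_coef// EFinM -muleA.
apply: lee_wpmul2l; first by rewrite lee_fin invr_ge0 powR_ge0.
apply: riesz_majorant_ge_on; rewrite ?powR_ge0//; first exact: measurable_eball.
move=> y; rewrite /eball/= => yr yx; apply: powRN_anti; first exact: ltW.
  by rewrite enorm_gt0 subr_eq0 eq_sym; apply/eqP.
by rewrite -enormN opprB ltW.
Qed.

End operators.

Unset Implicit Arguments.

Theorem theorem1p1 (R : realType) (n : nat) (s r : R) (f : 'rV[R]_n -> R)
    (hs0 : 0 < s) (hsn : s < n%:R)
    (hf : (lebesgue R n).-integrable [set: Rn R n] (EFin \o f))
    (hr1 : 1 <= r) (hr : r < n%:R / (n%:R - s)) :
  [/\ (weak_norm s r (riesz_potential s f) <=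
        (riesz_const n s * unit_ball_vol R n `^ ((n%:R - s) / n%:R) *
         (n%:R / (n%:R - (n%:R - s) * r)) `^ r^-1)%:E *
        'N[lebesgue R n]_1%:E [EFin \o f])%E,
      weak_norm s r (frac_maximal s f) =
        (((n%:R / (n%:R - (n%:R - s) * r)) `^ r^-1)%:E *
         'N[lebesgue R n]_1%:E [EFin \o f])%E
    & {ae lebesgue R n, forall x, 0 < f x} ->
      weak_norm s r (riesz_potential s f) =
        ((riesz_const n s * unit_ball_vol R n `^ ((n%:R - s) / n%:R) *
          (n%:R / (n%:R - (n%:R - s) * r)) `^ r^-1)%:E *
         'N[lebesgue R n]_1%:E [EFin \o f])%E].
Proof.
have mf : measurable_fun setT (f : Rn R n -> R).
  by apply/measurable_EFinP; exact: (measurable_int (lebesgue R n)).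
have norm1E : ('N[lebesgue R n]_1%:E [EFin \o f] =
    \int[lebesgue R n]_x `|f x|%:E)%E.
  exact: (Lnorm1 (lebesgue R n) (EFin \o f)).
rewrite norm1E.
have g0 : 0 <= riesz_const n s := riesz_const_ge0 n s.
have upper : (weak_norm s r (riesz_potential s f) <=
    (riesz_const n s * unit_ball_vol R n `^ ((n%:R - s) / n%:R) *
     (n%:R / (n%:R - (n%:R - s) * r)) `^ r^-1)%:E *
    \int[lebesgue R n]_x `|f x|%:E)%E.
  apply: weak_norm_le_of_majorant => // x.
  exact: riesz_potential_le_majorant.
split=> //.
- have v0 : unit_ball_vol R n `^ ((n%:R - s) / n%:R) != 0.
    by rewrite gt_eqF// powR_gt0// unit_ball_vol_gt0.
  have c0 : 0 <= (unit_ball_vol R n `^ ((n%:R - s) / n%:R))^-1.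
    by rewrite invr_ge0 powR_ge0.
  have majorant x := frac_maximal_le_majorant hs0 hsn x mf.
  have := weak_norm_le_of_majorant hsn hr1 hr c0 hf majorant.
  rewrite mulVf// mul1r => le_norm.
  apply/eqP; rewrite eq_le le_norm/=.
  have := @weak_norm_ge_of_minorant R n s r hsn hr1 hr _ f (frac_maximal s f) c0 hf.
  rewrite mulVf// mul1r; apply => x L L0.
  have xL : 0 < enorm x + L by rewrite ltr_wpDl ?enorm_ge0.
  rewrite gee0_abs ?frac_maximal_ge0//.
  apply: le_trans (frac_maximal_ge hs0 hsn f x xL).
  apply: lee_wpmul2l; first by rewrite lee_fin mulr_ge0// powR_ge0.
  apply: ge0_subset_integral.
  + exact: measurable_eball.
  + exact: measurable_eball.
  + by apply/measurable_funTS/measurable_EFinP; exact: measurableT_comp mf.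
  + by move=> y _; rewrite lee_fin.
  + move=> y; rewrite /eball/= subr0 => yL.
    by rewrite (le_lt_trans (ler_enormD _ _))// enormN addrC ltrD2l.
- move=> fpos; apply/eqP; rewrite eq_le upper/=.
  apply: weak_norm_ge_of_minorant => // x L L0.
  rewrite riesz_potential_pos_eq// gee0_abs.
    rewrite EFinM -muleA; apply: lee_wpmul2l; first by rewrite lee_fin.
    exact: riesz_majorant_ge_ball.
  rewrite mule_ge0 ?lee_fin//; apply: integral_ge0 => y _.
  by rewrite lee_fin mulr_ge0// riesz_kernel_ge0.
Qed.
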